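(* Let $W$ be a fixed trajectory of the environment, let $X$ be the associated Brox diffusion started at $0$, with scale function $s$, local time $L_X$ and first passage times $\tau(\cdot)$. Let $0<a<b$ be fixed. Then (under the law of $X$ with $W$ fixed) the random variable $L_X(\tau(b),a)$ is exponentially distributed with parameter (rate) $$\lambda:=\frac{e^{W(a)}}{2\,(s(b)-s(a))}.$$
   Context: The environment is $W=\{W(x):x\in\mathbb{R}\}$, a two-sided Brownian motion with $W(0)=0$, independent of a standard Brownian motion $B=\{B_t:t\ge 0\}$, $B_0=0$. A trajectory of $W$ is fixed, so $W:\mathbb{R}\to\mathbb{R}$ is a deterministic continuous function with $W(0)=0$, and all probabilities and expectations are with respect to $B$ only. The scale function is $s(x):=\int_0^x e^{W(y)}\,dy$; the trajectory is assumed to be such that $s$ is a bijection of $\mathbb{R}$ onto $\mathbb{R}$ (this holds for almost every trajectory of $W$). Put $T_t:=\int_0^t e^{-2W(s^{-1}(B_u))}\,du$ for $t\ge 0$, and let $T^{-1}$ denote the inverse of $t\mapsto T_t$. The Brox diffusion in the environment $W$ is $X_t:=s^{-1}(B_{T^{-1}_t})$, $t\ge 0$; it is the diffusion with generator $Lf(x)=\frac12 e^{W(x)}\frac{d}{dx}\left(e^{-W(x)}\frac{df(x)}{dx}\right)$. Its local time $L_X=\{L_X(t,x):t\ge 0,x\in\mathbb{R}\}$ is the jointly continuous process such that $\int_0^t f(X_u)\,du=\int_{-\infty}^{\infty} f(x)L_X(t,x)\,dx$ for all $t\ge0$ and all measurable $f$ (for example, nonnegative or bounded $f$); equivalently $L_X(t,x)=e^{-W(x)}L_B(T^{-1}(t),s(x))$,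 where $L_B$ is the local time of $B$ (occupation density with respect to Lebesgue measure). The first passage time is $\tau(b):=\inf\{t\ge 0:X_t=b\}$. *)

(* Defs.v *)
From HB Require Import structures.
From mathcomp Require Import all_boot all_order all_algebra.
From mathcomp Require Import all_classical all_reals all_analysis.

Set Implicit Arguments.
Unset Strict Implicit.
Unset Printing Implicit Defensive.

Import Order.TTheory GRing.Theory Num.Theory.
Import numFieldNormedType.Exports.

Local Open Scope classical_set_scope.
Local Open Scope ring_scope.

(* Real-valued processes are families indexed by all of [R]; only the indices
   [0 <= t] are constrained or used. *)

Section brownian_motion.
Context {R : realType} {d : measure_display} {Omega : measurableType d}.
Variable P : probability Omega R.

(* The product rule for subfamilies is the case where some of the [A i] are
   [setT]. *)
Definition mutually_independent (n : nat) (Y : 'I_n -> Omega -> R) : Prop :=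
  forall A : 'I_n -> set R, (forall i, measurable (A i)) ->
    P (\bigcap_(i in [set: 'I_n]) (Y i @^-1` A i)) =
    (\prod_(i < n) P (Y i @^-1` A i))%E.

Record standard_brownian_motion (B : R -> {RV P >-> R}) : Prop := {
  bm_start : {ae P, forall w, B 0 w = 0} ;
  bm_indep : forall (n : nat) (t : nat -> R), 0 <= t 0%N ->
    nondecreasing_seq t ->
    @mutually_independent n (fun i w => B (t i.+1) w - B (t i) w) ;
  (* the second parameter of [normal_prob] is the standard deviation *)
  bm_gauss : forall s t : R, 0 <= s -> s < t ->
    forall A : set R, measurable A ->
      P ((fun w => B t w - B s w) @^-1` A) =
      normal_prob 0 (Num.sqrt (t - s)) A ;
  bm_cont : {ae P, forall w, {within `[0, +oo[, continuous (B ^~ w)}} }.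

(* [Y] need only agree almost surely with a genuine random variable: [P] is not
   assumed complete, and functionals of the paths defined up to a null set may
   fail to be measurable for the uncompleted sigma-algebra. *)
Definition exponentially_distributed (rate : R) (Y : Omega -> R) : Prop :=
  exists Z : {RV P >-> R},
    {ae P, forall w, Y w = Z w} /\
    forall A : set R, measurable A ->
      distribution P Z A = exponential_prob rate A.

End brownian_motion.

Section brox.
Context {R : realType}.
Local Notation mu := (@lebesgue_measure R).

Definition scale (W : R -> R) (x : R) : R :=
  if 0 <= x then \int[mu]_(y in `[0, x]) expR (W y)
  else - \int[mu]_(y in `[x, 0]) expR (W y).

Definition scale_inv (W : R -> R) : R -> R :=
  'pinv_(fun=> 0) [set: R] (scale W).

Section path.
(* [beta] is one trajectory of the driving Brownian motion. *)
Variables (W beta : R -> R).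

Definition time_change (t : R) : R :=
  \int[mu]_(u in `[0, t]) expR (- 2 * W (scale_inv W (beta u))).

(* On the null set of trajectories where [time_change] does not map [0, +oo[
   onto itself, the inverse takes the value 0 at the times not attained. *)
Definition time_change_inv : R -> R :=
  'pinv_(fun=> 0) `[0, +oo[ time_change.

Definition brox (t : R) : R := scale_inv W (beta (time_change_inv t)).

End path.

Definition first_passage (X : R -> R) (b : R) : \bar R :=
  ereal_inf [set t%:E | t in [set t : R | 0 <= t /\ X t = b]].

(* [l] is the local time of the single trajectory [X]. *)
Record is_local_time (X : R -> R) (l : R -> R -> R) : Prop := {
  local_time_cont :
    {within [set p : R * R | 0 <= p.1], continuous (fun p => l p.1 p.2)} ;
  occupation : forall (t : R) (f : R -> R), 0 <= t ->
    measurable_fun [set: R] f -> (forall x, 0 <= f x) ->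
    (\int[mu]_(u in `[0%R, t]) (f (X u))%:E =
     \int[mu]_x (f x * l t x)%:E)%E }.

End brox.

(* Main.v *)
Require Import Defs.
From HB Require Import structures.
From mathcomp Require Import all_boot all_order all_algebra.
From mathcomp Require Import all_classical all_reals all_analysis.
From mathcomp Require Import measurable_realfun ring lra.
Import Order.TTheory GRing.Theory Num.Theory.
Import numFieldNormedType.Exports.
Local Open Scope classical_set_scope.
Local Open Scope ring_scope.
Set Implicit Arguments.
Unset Strict Implicit.
Unset Printing Implicit Defensive.

(** The idea is to compute the Laplace transform of [L(tau(b), a)] and to
    recognise that of an exponential law.

    Write [y = s(a)], [c = s(b)], and let [sigma] be the time at which [B]
    reaches [c]. The time change [T] carries [sigma] to [tau(b)]. Substituting
    first in time and then in space, the occupation formula at time [tau(b)]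
    becomes ([occupation_scale])

      [int_0^sigma q(B_u) du = int q(r) e^(W(x)) L(tau(b), x) dr], [x = s^-1(r)].

    If [q] is nearly a point mass at [y], the right-hand side is nearly
    [e^(W(a)) L(tau(b), a)], because [L(tau(b), .)] is continuous. So it is
    enough to know the Laplace transform of the left-hand side when [q] is a
    narrow bump at [y].

    For this there is an explicit formula. If [u'' = 2 V u] below the level [c],
    then [exp(- int_0^t V(B)) u(B_t)] stopped at [sigma] is a martingale
    ([feynman_kac]), so [E exp(- int_0^sigma V(B)) = u(0) / u(c)]. Let [phi] be
    a tent of unit mass on [[y, y + 2 e]] and [U] the function with [U'' = phi]
    that vanishes to the left of [y]. Then [u = 1 + 2 lam U] and
    [V = lam phi / u] are a solution with [u(0) = 1] and [u(c) = 1 + 2 lam (c - y - e)]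
    ([occupation_laplace]). As [e] tends to [0], [U] tends to [0] on the tent, so
    [V] approaches [lam] times a point mass at [y] ([tent_rate_average]), and

      [E exp(- lam e^(W(a)) L(tau(b), a)) = 1 / (1 + 2 lam (c - y))],

    which is the transform of the exponential law of rate [e^(W(a)) / (2 (c - y))].

    The martingale property comes from a direct discretisation. Over a time step
    [h], independence of the increments and a Gaussian Taylor expansion show
    that the mean of the killed process moves by [O(h^(3/2))] ([one_step]); there
    are [O(1/h)] steps before a fixed horizon, so the total error vanishes with
    [h]. Stopping at the level [c] only requires that the event that the path
    stays below [c] up to the start of a step be a limit of events of the past,
    which is done with finer and finer dyadic grids ([before_level_step]). The
    same identity with [u(x) = exp(th x)] and [th] tending to [0] shows that
    every level is reached ([hits_level]).

    Finally the transform at the integers gives the moments of [exp(- Y)], a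
    variable in [[0, 1]], and these determine its law because polynomials
    converge boundedly to the indicator of [[0, a[] ([moments_determine]). *)


(** * Gaussian integrals *)

Section density.
Context {R : realType}.
Notation mu := (@lebesgue_measure R).
Implicit Types (f g p : R -> R).

(** A density is a version of the Radon-Nikodym derivative. *)
Lemma integral_density (nu : probability (measurableTypeR R) R) p :
  measurable_fun setT p -> (forall x, 0 <= p x) ->
  (forall A, measurable A -> nu A = (\int[mu]_(x in A) (p x)%:E)%E) ->
  forall f, nu.-integrable setT (EFin \o f) ->
  (\int[nu]_x (f x)%:E = \int[mu]_x (f x * p x)%:E)%E.
Proof.
move=> mp p0 nuE f intf.
have dom : nu `<< mu.
  apply/null_content_dominatesP => A mA muA0; rewrite nuE//.
  apply: null_set_integral => //=.
  apply: measurable_funTS; exact/measurable_EFinP.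
have intp : mu.-integrable setT (EFin \o p).
  apply/integrableP; split; first exact/measurable_EFinP.
  under eq_integral do rewrite /= ger0_norm//.
  by rewrite -nuE// probability_setT ltry.
rewrite -(Radon_Nikodym_change_of_variables dom)//=.
under [RHS]eq_integral do rewrite EFinM.
apply: ae_eq_integral => //.
- apply: emeasurable_funM; first exact: (measurable_int nu).
  by apply: (measurable_int mu); exact: Radon_Nikodym_integrable.
- apply: emeasurable_funM; first exact: (measurable_int nu).
  exact/measurable_EFinP.
- apply: ae_eqe_mul2l => /=.
  apply: integral_ae_eq => //=.
  + exact: Radon_Nikodym_integrable.
  + exact/measurable_EFinP.
  + by move=> E E01 mE; rewrite -Radon_Nikodym_integral//= nuE.
Qed.

End density.

Section gaussian_moments.
Context {R : realType}.
Notation mu := (@lebesgue_measure R).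
Implicit Types (f F u : R -> R).

(** With [F] a polynomial times the Gaussian density this is integration by
    parts; the integral of [f] over [[- n, n]] is an increment of [F]. *)
Lemma integral_derivative_vanishing f F :
  continuous f -> (forall x : R, is_derive x (1:R) F (f x)) ->
  mu.-integrable setT (EFin \o f) ->
  (F n%:R - F (- n%:R)) @[n --> \oo] --> (0:R) ->
  (\int[mu]_x (f x)%:E = 0)%E.
Proof.
move=> cf dF intf F0.
pose g (n : nat) := (EFin \o f) \_ `[- n%:R, n%:R].
have mf : measurable_fun setT f by exact: continuous_measurable_fun.
have mg n : measurable_fun setT (g n).
  apply/(measurable_restrict _ _ _).1 => //.
  by rewrite setTI; apply: measurable_funTS; exact/measurable_EFinP.
have cvg_int : (\int[mu]_x g n x @[n --> \oo] --> \int[mu]_x (f x)%:E)%E.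
  have [||_ _ //] := @dominated_convergence _ _ _ mu setT measurableT g
    (EFin \o f) (abse \o (EFin \o f)) mg (measurable_int mu intf) _
    (integrable_abse intf).
  - apply: aeW => x _; apply: cvg_near_cst.
    near=> n.
    rewrite /g patchE mem_set//= in_itv/=.
    have : `|x| <= n%:R.
      near: n; exact: nbhs_infty_ger.
    by rewrite ler_norml.
  - apply: aeW => x n _ /=; rewrite /g patchE; case: ifPn => //= _.
    by rewrite lee_fin normr0.
have cF : continuous F.
  move=> x; apply: differentiable_continuous.
  by apply/derivable1_diffP; have [] := dF x.
have gE : \forall n \near \oo, (\int[mu]_x g n x = (F n%:R - F (- n%:R))%:E)%E.
  near=> n.
  have n0 : (0 < n%:R :> R) by rewrite ltr0n; near: n; exact: nbhs_infty_gt.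
  rewrite /g -integral_mkcond.
  rewrite (@continuous_FTC2 R f F) ?EFinB//.
  - by rewrite (lt_trans _ n0)// oppr_lt0.
  - exact: continuous_subspaceT.
  - split.
    + by move=> x _; have [] := dF x.
    + by apply/cvg_at_right_filter; exact: cF.
    + by apply/cvg_at_left_filter; exact: cF.
  - by move=> x _; rewrite derive1E; have [] := dF x.
have : (\int[mu]_x g n x @[n --> \oo] --> 0)%E.
  apply: (@cvg_trans _ ((F n%:R - F (- n%:R))%:E @[n --> \oo])).
    by apply: near_eq_cvg; near=> n; apply/esym; near: n.
  by apply/fine_cvgP; split; [exact: nearW|exact: F0].
by apply: cvg_unique.
Unshelve. all: end_near. Qed.

Variable s : R.
Hypothesis s0 : 0 < s.
Let q (x : R) := normal_pdf 0 s x.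

Let qE x : q x = normal_peak s * expR (- (x ^+ 2 / (s ^+ 2 *+ 2))).
Proof. by rewrite /q normal_pdfE ?gt_eqF// /normal_fun subr0 mulNr. Qed.

Let cq : continuous q.
Proof. by apply: continuous_normal_pdf; rewrite gt_eqF. Qed.

Let q0 x : 0 <= q x. Proof. exact: normal_pdf_ge0. Qed.

(** The factor [exp(- z^2 / 2)], with [z = x / s], is [exp(- z^2 / 4)], which
    belongs to the density of twice the variance, times the square of
    [exp(- z^2 / 8) <= 8 / (8 + z^2)], which absorbs any cubic polynomial. *)
Lemma normal_pdf_moment_bound x :
  (1 + `|x / s| + (x / s) ^+ 2 + `|x / s| ^+ 3) * q x <= 256 * normal_pdf 0 (s * Num.sqrt 2) x.
Proof.
have s2 : 0 < s * Num.sqrt 2 by rewrite mulr_gt0// sqrtr_gt0.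
rewrite normal_pdfE ?gt_eqF// /normal_fun subr0 qE.
set z := x / s.
have zE : x ^+ 2 / (s ^+ 2 *+ 2) = z ^+ 2 / 2.
  by rewrite /z; field; rewrite gt_eqF.
have zE' : - x ^+ 2 / ((s * Num.sqrt 2) ^+ 2 *+ 2) = - (z ^+ 2 / 4).
  rewrite exprMn sqr_sqrtr// /z; field; by rewrite gt_eqF.
have pk : normal_peak s = Num.sqrt 2 * normal_peak (s * Num.sqrt 2).
  rewrite /normal_peak exprMn sqr_sqrtr//.
  rewrite (_ : s ^+ 2 * 2 * pi *+ 2 = 2 * (s ^+ 2 * pi *+ 2)); last first.
    by rewrite -[LHS]mulr_natr -[X in _ = _ * X]mulr_natr [s ^+ 2 * 2]mulrC -!mulrA.
  rewrite sqrtrM// invfM mulrA divff ?mul1r//.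
rewrite zE zE' pk.
set p := normal_peak _.
have p0 : 0 <= p by exact: normal_peak_ge0.
have sq2 : Num.sqrt 2 <= 2 :> R.
  have h : 2 <= 2 ^+ 2 :> R by rewrite expr2; lra.
  by rewrite -[leRHS]ger0_norm// -sqrtr_sqr ler_wsqrtr.
have e4 : expR (- (z ^+ 2 / 2)) = expR (- (z ^+ 2 / 4)) * expR (- (z ^+ 2 / 8)) ^+ 2.
  rewrite -expRM_natl -expRD; congr expR; by field.
set a := expR (- (z ^+ 2 / 8)) in e4 *.
set b := expR (- (z ^+ 2 / 4)) in e4 *.
have b0 : 0 < b by exact: expR_gt0.
have a0 : 0 < a by exact: expR_gt0.
have az : a * (1 + z ^+ 2 / 8) <= 1.
  apply: (@le_trans _ _ (a * expR (z ^+ 2 / 8))); last first.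
    by rewrite /a -expRD addNr expR0.
  by rewrite ler_pM2l// expR_ge1Dx.
have key : (1 + `|z| + z ^+ 2 + `|z| ^+ 3) * a ^+ 2 <= 128.
  have z2 : z ^+ 2 = `|z| ^+ 2 by rewrite real_normK// num_real.
  have : a * (8 + z ^+ 2) <= 8 by lra.
  rewrite z2; set w := `|z|; have w0 : 0 <= w by exact: normr_ge0.
  move=> h.
  have h2 : (a * (8 + w ^+ 2)) ^+ 2 <= 64.
    rewrite (_ : 64 = 8 ^+ 2); last by rewrite expr2; lra.
    rewrite lerXn2r ?nnegrE//; nra.
  apply: le_trans (_ : 2 * (a * (8 + w ^+ 2)) ^+ 2 <= _); last lra.
  have -> : 2 * (a * (8 + w ^+ 2)) ^+ 2 = (2 * (8 + w ^+ 2) ^+ 2) * a ^+ 2.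
    by ring.
  rewrite ler_pM2r ?exprn_gt0//.
  have := sqr_ge0 (w ^+ 2 - w); have := sqr_ge0 (w - 1); nra.
rewrite e4.
have -> : (1 + `|z| + z ^+ 2 + `|z| ^+ 3) * (Num.sqrt 2 * p * (b * a ^+ 2)) =
  ((1 + `|z| + z ^+ 2 + `|z| ^+ 3) * a ^+ 2) * Num.sqrt 2 * (p * b) by ring.
apply: ler_wpM2r; first by rewrite mulr_ge0// ltW.
apply: le_trans (ler_pM _ _ key sq2) _; last lra.
- by rewrite mulr_ge0 ?exprn_ge0 ?addr_ge0 ?sqr_ge0 ?exprn_ge0// ltW.
- exact: sqrtr_ge0.
Qed.

Let normal_integrable f (K : R) : measurable_fun setT f ->
  (forall x, `|f x| <= K * (1 + `|x / s| + (x / s) ^+ 2 + `|x / s| ^+ 3)) ->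
  mu.-integrable setT (fun x => (f x * q x)%:E).
Proof.
move=> mf fK.
have K0 : 0 <= K.
  have := fK 0; rewrite mul0r normr0 !expr0n/= !addr0 mulr1.
  exact: le_trans.
have mfq : measurable_fun setT (fun x => f x * q x).
  by apply: measurable_funM => //; exact: continuous_measurable_fun.
apply: (@le_integrable _ _ _ mu setT _ _
   (fun x => ((K * 256) * normal_pdf 0 (s * Num.sqrt 2) x)%:E)) => //.
- exact/measurable_EFinP.
- move=> x _; rewrite /= lee_fin normrM (ger0_norm (q0 x)).
  rewrite [leRHS]ger0_norm; last by rewrite !mulr_ge0// normal_pdf_ge0.
  rewrite -mulrA; apply: le_trans (ler_wpM2l K0 (normal_pdf_moment_bound x)).
  by rewrite mulrA ler_wpM2r.
- under eq_fun do rewrite EFinM.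
  apply: integrableZl => //; exact: integrable_normal_pdf.
Qed.

Let is_derive_q (x : R) : is_derive x (1:R) q (- (x / s ^+ 2) * q x).
Proof.
have -> : q = (fun x => normal_peak s * expR (- (x ^+ 2 / (s ^+ 2 *+ 2)))).
  by apply/funext => y; exact: qE.
apply: is_derive_eq.
rewrite /GRing.scale/=; field; by rewrite gt_eqF.
Qed.

Let cvg_nq : (n%:R * q n%:R) @[n --> \oo] --> (0:R).
Proof.
pose C := normal_peak s * (s ^+ 2 *+ 2).
have C0 : 0 <= C by rewrite mulr_ge0 ?normal_peak_ge0 ?mulrn_wge0 ?sqr_ge0.
apply: (@squeeze_cvgr _ _ _ _ (fun=> 0) (fun n => (C * 2) * n.+1%:R^-1)).
- near=> n; rewrite mulr_ge0//=.
  have n0 : (0 < n%:R :> R) by rewrite ltr0n; near: n; exact: nbhs_infty_gt.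
  rewrite qE /C.
  set p := normal_peak s; have p0 : 0 <= p by exact: normal_peak_ge0.
  set v := s ^+ 2 *+ 2; have v0 : 0 < v by rewrite mulrn_wgt0// exprn_gt0.
  have e1 : expR (- (n%:R ^+ 2 / v)) <= v / n%:R ^+ 2.
    rewrite expRN -[leRHS]invrK lef_pV2 ?posrE ?expR_gt0 ?invr_gt0 ?divr_gt0 ?exprn_gt0//.
    rewrite invf_div (le_trans _ (expR_ge1Dx _))//; lra.
  have : n%:R * (p * expR (- (n%:R ^+ 2 / v))) <= n%:R * (p * (v / n%:R ^+ 2)).
    by rewrite ler_pM2l// ler_wpM2l.
  move=> /le_trans; apply.
  have -> : n%:R * (p * (v / n%:R ^+ 2)) = p * v / n%:R by field; rewrite gt_eqF.
  rewrite -[leRHS]mulrA ler_wpM2l// ?mulr_ge0 ?(ltW v0)// [leRHS]mulrC.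
  rewrite -[leRHS]invrK invfM invrK lef_pV2 ?posrE ?mulr_gt0 ?invr_gt0 ?n0 ?ltr0n//.
  rewrite -natr1 ler_pdivrMr//; suff : (1 <= n%:R :> R) by lra.
  by rewrite ler1n; near: n; exact: nbhs_infty_gt.
- exact: cvg_cst.
- rewrite -(mulr0 (C * 2)); apply: cvgM; [exact: cvg_cst|exact: cvg_harmonic].
Unshelve. all: end_near. Qed.

Lemma normal_pdf_moment1 : (\int[mu]_x (x * q x)%:E = 0)%E.
Proof.
apply: (@integral_derivative_vanishing _ (fun x => - s ^+ 2 * q x)).
- by move=> x; apply: cvgM => //; exact: cq.
- move=> x; have dq := is_derive_q x; apply: is_derive_eq.
  rewrite /GRing.scale/=; field; by rewrite gt_eqF.
- apply: (@normal_integrable _ s) => [|x]; first exact: measurable_id.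
  have {1}-> : x = s * (x / s) by rewrite mulrC divfK// gt_eqF.
  rewrite normrM gtr0_norm// ler_pM2l//.
  have := sqr_ge0 (x / s); have : 0 <= `|x / s| ^+ 3 by rewrite exprn_ge0.
  lra.
- apply: cvg_near_cst; apply: nearW => n.
  by rewrite !qE sqrrN subrr.
Qed.

Lemma normal_pdf_moment2 : (\int[mu]_x (x ^+ 2 * q x)%:E = (s ^+ 2)%:E)%E.
Proof.
have i1 : mu.-integrable setT (fun x => (q x)%:E) by exact: integrable_normal_pdf.
have i2 : mu.-integrable setT (fun x => (x ^+ 2 * q x)%:E).
  apply: (@normal_integrable _ (s ^+ 2)) => [|x].
    exact: measurable_funX.
  have {1}-> : x = s * (x / s) by rewrite mulrC divfK// gt_eqF.
  rewrite normrX normrM gtr0_norm// exprMn ler_pM2l ?exprn_gt0// real_normK ?num_real//.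
  have := normr_ge0 (x / s); have : 0 <= `|x / s| ^+ 3 by rewrite exprn_ge0.
  lra.
have i3 : mu.-integrable setT (fun x => (- s ^- 2 * (x ^+ 2 * q x))%:E).
  by under eq_fun do rewrite EFinM; exact: integrableZl.
have : (\int[mu]_x (q x + - s ^- 2 * (x ^+ 2 * q x))%:E = 0)%E.
  apply: (@integral_derivative_vanishing _ (fun x => x * q x)).
  - move=> x; apply: cvgD; first exact: cq.
    apply: cvgM; first exact: cvg_cst.
    by apply: cvgM; [exact: exprn_continuous|exact: cq].
  - move=> x; have dq := is_derive_q x; apply: is_derive_eq.
    rewrite /GRing.scale/=; field; by rewrite gt_eqF.
  - rewrite (_ : _ \o _ = (fun x => (q x)%:E) \+ (fun x => (- s ^- 2 * (x ^+ 2 * q x))%:E))%E//.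
    exact: integrableD.
  - rewrite (_ : (fun n => _) = (fun n => n%:R * q n%:R + n%:R * q n%:R)).
      rewrite -[X in _ --> X](addr0 (0:R)); exact: cvgD.
    apply/funext => n; rewrite mulNr opprK; congr (_ + _ * _).
    by rewrite !qE sqrrN.
under eq_integral do rewrite EFinD.
rewrite integralD// integral_normal_pdf.
under [X in (_ + X)%E]eq_integral do rewrite EFinM.
rewrite integralZl//.
have /fineK <- := integrable_fin_num measurableT i2.
set m := fine _; rewrite -EFinM -EFinD => -[] h; congr (_%:E).
have -> : m = s ^+ 2 * (s ^- 2 * m) by rewrite mulrA divff ?mul1r// expf_neq0// gt_eqF.
by rewrite (_ : s ^- 2 * m = 1) ?mulr1//; lra.
Qed.

(** Third-order Taylor remainders integrate to third powers of the standard
    deviation, and the linear term disappears by symmetry. *)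
Lemma normal_taylor (g : R -> R) (g1 g2 K : R) :
  measurable_fun setT g -> (exists M, forall z, `|g z| <= M) ->
  (forall z, `|g z - g 0 - g1 * z - g2 * z ^+ 2| <= K * `|z| ^+ 3) ->
  `| \int[normal_prob 0 s]_z g z - g 0 - g2 * s ^+ 2| <= 256 * K * s ^+ 3.
Proof.
move=> mg [M gM] gK.
have K0 : 0 <= K.
  by have := gK 1; rewrite normr1 !expr1n !mulr1; apply: le_trans; exact: normr_ge0.
have s1 : s != 0 by rewrite gt_eqF.
have i0 : mu.-integrable setT (fun z => (q z)%:E) by exact: integrable_normal_pdf.
have i1 : mu.-integrable setT (fun z => (z * q z)%:E).
  apply: (@normal_integrable _ s) => [|x]; first exact: measurable_id.
  have {1}-> : x = s * (x / s) by rewrite mulrC divfK.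
  rewrite normrM gtr0_norm// ler_pM2l//.
  have := sqr_ge0 (x / s); have : 0 <= `|x / s| ^+ 3 by rewrite exprn_ge0.
  lra.
have i2 : mu.-integrable setT (fun z => (z ^+ 2 * q z)%:E).
  apply: (@normal_integrable _ (s ^+ 2)) => [|x]; first exact: measurable_funX.
  have {1}-> : x = s * (x / s) by rewrite mulrC divfK.
  rewrite normrX normrM gtr0_norm// exprMn ler_pM2l ?exprn_gt0// real_normK ?num_real//.
  have := normr_ge0 (x / s); have : 0 <= `|x / s| ^+ 3 by rewrite exprn_ge0.
  lra.
have i3 : mu.-integrable setT (fun z => (`|z| ^+ 3 * q z)%:E).
  apply: (@normal_integrable _ (s ^+ 3)) => [|x].
    apply: continuous_measurable_fun => y.
    exact: (continuous_comp (@norm_continuous _ _ y) (@exprn_continuous _ 3 _)).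
  have {1}-> : x = s * (x / s) by rewrite mulrC divfK.
  rewrite normrX normr_id normrM gtr0_norm// exprMn ler_pM2l ?exprn_gt0//.
  have := normr_ge0 (x / s); have := sqr_ge0 (x / s).
  lra.
have ig : mu.-integrable setT (fun z => (g z * q z)%:E).
  apply: (@normal_integrable _ M) => // x; apply: (le_trans (gM x)).
  have M0 : 0 <= M by apply: le_trans (gM 0); exact: normr_ge0.
  rewrite ler_peMr//.
  have := normr_ge0 (x / s); have := sqr_ge0 (x / s).
  have : 0 <= `|x / s| ^+ 3 by rewrite exprn_ge0.
  lra.
have -> : \int[normal_prob 0 s]_z g z = \int[mu]_z (g z * q z).
  congr fine; apply: integral_density => //; first exact: measurable_normal_pdf.
  apply/integrableP; split; first exact/measurable_EFinP.
  apply: (@le_lt_trans _ _ (\int[normal_prob 0 s]_z (M%:E))%E).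
    apply: ge0_le_integral => //=.
    - by apply/measurable_EFinP; exact: measurableT_comp.
    - by move=> x _; rewrite lee_fin.
  rewrite [ltLHS](_ : _ = M%:E * normal_prob 0 s setT)%E; last exact: integral_cst.
  by rewrite probability_setT mule1 ltry.
have m0 : \int[mu]_z q z = 1 by rewrite /Rintegral integral_normal_pdf.
have m1 : \int[mu]_z (z * q z) = 0 by rewrite /Rintegral normal_pdf_moment1.
have m2 : \int[mu]_z (z ^+ 2 * q z) = s ^+ 2 by rewrite /Rintegral normal_pdf_moment2.
have iZ (k : R) (f : R -> R) : mu.-integrable setT (fun z => (f z)%:E) ->
    mu.-integrable setT (fun z => (k * f z)%:E).
  by move=> h; under eq_fun do rewrite EFinM; exact: integrableZl.
have iD (f h : R -> R) : mu.-integrable setT (fun z => (f z)%:E) ->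
    mu.-integrable setT (fun z => (h z)%:E) ->
    mu.-integrable setT (fun z => (f z - h z)%:E).
  by move=> ? ?; under eq_fun do rewrite EFinB; exact: integrableB.
have -> : \int[mu]_z (g z * q z) - g 0 - g2 * s ^+ 2 =
    \int[mu]_z (g z * q z - g 0 * q z - g1 * (z * q z) - g2 * (z ^+ 2 * q z)).
  rewrite RintegralB//; [|by do 2 (apply: (iD) => //; last exact: (iZ))|exact: (iZ)].
  rewrite RintegralB//; [|by apply: (iD) => //; exact: (iZ)|exact: (iZ)].
  rewrite RintegralB//; [|exact: iZ].
  by rewrite !RintegralZl// m0 m1 m2 mulr1 mulr0 subr0.
apply: le_trans (le_normr_Rintegral _ _) _ => //.
  by do 3 (apply: (iD) => //; last exact: (iZ)).
apply: (@le_trans _ _ (\int[mu]_z (256 * K * s ^+ 3 * normal_pdf 0 (s * Num.sqrt 2) z))).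
  apply: le_Rintegral => //.
  - apply: (@integrable_abse _ _ _ mu setT (fun z => (g z * q z - g 0 * q z - g1 * (z * q z) - g2 * (z ^+ 2 * q z))%:E)).
    by do 3 (apply: (iD) => //; last exact: (iZ)).
  - apply: iZ; exact: integrable_normal_pdf.
  - move=> z _.
    have -> : g z * q z - g 0 * q z - g1 * (z * q z) - g2 * (z ^+ 2 * q z) =
      (g z - g 0 - g1 * z - g2 * z ^+ 2) * q z by ring.
    rewrite normrM (ger0_norm (q0 z)).
    apply: le_trans (ler_wpM2r (q0 z) (gK z)) _.
    have -> : K * `|z| ^+ 3 * q z = K * s ^+ 3 * (`|z / s| ^+ 3 * q z).
      by rewrite normrM normfV (gtr0_norm s0); field.
    have -> : 256 * K * s ^+ 3 * normal_pdf 0 (s * Num.sqrt 2) z =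
      K * s ^+ 3 * (256 * normal_pdf 0 (s * Num.sqrt 2) z) by ring.
    apply: ler_wpM2l; first by rewrite mulr_ge0// exprn_ge0// ltW.
    apply: le_trans (normal_pdf_moment_bound z).
    apply: ler_wpM2r => //.
    have := normr_ge0 (z / s); have := sqr_ge0 (z / s).
    lra.
rewrite RintegralZl//; last exact: integrable_normal_pdf.
by rewrite /Rintegral integral_normal_pdf mulr1.
Qed.

End gaussian_moments.

(** * Means up to null sets, and freezing *)

Section bounded_variables.
Context {R : realType} {d : measure_display} {Omega : measurableType d}.
Variable P : probability Omega R.
Implicit Types X Z : Omega -> R.

(** A functional of the path that is defined up to a null set need not be
    measurable, so its mean is that of a measurable version. *)
Definition has_mean X (m : R) : Prop := exists Z : Omega -> R,
  [/\ measurable_fun setT Z, {ae P, forall w, X w = Z w} &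
      (\int[P]_w (Z w)%:E = m%:E)%E].

Lemma bounded_integrable X C : measurable_fun setT X ->
  (forall w, `|X w| <= C) -> P.-integrable setT (EFin \o X).
Proof.
move=> mX XC; apply: (@le_integrable _ _ _ P setT _ _ (EFin \o cst C)) => //.
- exact/measurable_EFinP.
- by move=> w _; rewrite /= lee_fin (le_trans (XC w))// ler_norm.
- exact: finite_measure_integrable_cst.
Qed.

Lemma has_mean_ae X X' m : {ae P, forall w, X w = X' w} ->
  has_mean X m -> has_mean X' m.
Proof.
move=> XX' [Z [mZ XZ EZ]]; exists Z; split => //.
by apply: filterS2 XX' XZ => w <-.
Qed.

Lemma has_mean_scale k X m : has_mean X m -> has_mean (fun w => k * X w) (k * m).
Proof.
move=> [Z [mZ XZ EZ]]; exists (fun w => k * Z w); split.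
- exact: measurable_funM.
- by apply: filterS XZ => w ->.
- have mZ' : measurable_fun setT (EFin \o Z) by exact/measurable_EFinP.
  have : P.-integrable setT (EFin \o Z).
    apply/integrableP; split => //.
    by rewrite integral_fin_num_abs// EZ.
  by move=> iZ; under eq_integral do rewrite EFinM; rewrite integralZl// EZ.
Qed.

(** Dominated convergence. The upper limit of measurable versions is again
    measurable, and it is a version of the limit. *)
Lemma has_mean_cvg (X_ : nat -> Omega -> R) X (C : R) (m_ : nat -> R) (m : R) :
  (forall n, has_mean (X_ n) (m_ n)) ->
  {ae P, forall w, forall n, `|X_ n w| <= C} ->
  {ae P, forall w, X_ n w @[n --> \oo] --> X w} ->
  m_ n @[n --> \oo] --> m -> has_mean X m.
Proof.
move=> /choice[Z_ hZ_] bX cX cm.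
have mZ n : measurable_fun setT (EFin \o Z_ n).
  by apply/measurable_EFinP; have [] := hZ_ n.
have XZ : {ae P, forall w, forall n, X_ n w = Z_ n w}.
  by apply: ae_foralln => n; have [] := hZ_ n.
pose Z w := fine (limn_esup (fun n => (Z_ n w)%:E)).
have mZ' : measurable_fun setT Z.
  apply: (measurableT_comp (fine_measurable measurableT)).
  exact: measurable_fun_limn_esup.
have cZ : {ae P, forall w, (Z_ n w)%:E @[n --> \oo] --> (Z w)%:E /\ X w = Z w}.
  apply: filterS2 XZ cX => w XZw cXw.
  have cE : (Z_ n w)%:E @[n --> \oo] --> (X w)%:E.
    apply/fine_cvgP; split; first exact: nearW.
    by rewrite (_ : _ \o _ = X_ ^~ w)//; apply/funext => n /=; rewrite XZw.
  have -> : Z w = X w by rewrite /Z (cvg_limn_einf_sup cE).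
  by [].
exists Z; split => //.
  by apply: filterS cZ => w [].
have mEZ : measurable_fun setT (EFin \o Z) by exact/measurable_EFinP.
have cEZ : {ae P, forall w, setT w -> (EFin \o Z_ n) w @[n --> \oo] --> (EFin \o Z) w}.
  by apply: filterS cZ => w [].
have bEZ : {ae P, forall w, forall n, setT w -> (`|(EFin \o Z_ n) w| <= (EFin \o cst C) w)%E}.
  by apply: filterS2 XZ bX => w XZw bXw n _ /=; rewrite lee_fin -XZw.
have [_ _ cvg_int] := dominated_convergence measurableT mZ mEZ cEZ
  (finite_measure_integrable_cst P C measurableT) bEZ.
have cE : ((m_ n)%:E @[n --> \oo] --> m%:E)%E.
  by apply/fine_cvgP; split; [exact: nearW|exact: cm].
apply: (cvg_unique _ _ cE) => //.
rewrite (_ : (fun n => (m_ n)%:E) = (fun n => (\int[P]_w (Z_ n w)%:E)%E))//.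
by apply/funext => n; have [_ _ ->] := hZ_ n.
Qed.

Lemma bounded_cvg (X_ : nat -> Omega -> R) X (M : R) :
  (forall n, measurable_fun setT (X_ n)) -> (forall n w, `|X_ n w| <= M) ->
  (forall w, X_ n w @[n --> \oo] --> X w) ->
  \int[P]_w X_ n w @[n --> \oo] --> \int[P]_w X w.
Proof.
move=> mX XM cX.
have mX' n : measurable_fun setT (EFin \o X_ n) by exact/measurable_EFinP.
have mXl : measurable_fun setT (EFin \o X).
  apply/measurable_EFinP.
  by apply: (measurable_fun_cvg mX) => w _; exact: cX.
have [||iX _ cvg_int] := dominated_convergence measurableT mX' mXl _
  (finite_measure_integrable_cst P M measurableT).
- apply: aeW => w _; apply/fine_cvgP; split; [exact: nearW|exact: cX].
- by apply: aeW => w n _; rewrite /= lee_fin.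
by apply: fine_cvg; rewrite fineK//; exact: integrable_fin_num.
Qed.

Lemma bounded_cvg_bound (X_ : nat -> Omega -> R) X (M C : R) :
  (forall n, measurable_fun setT (X_ n)) -> (forall n w, `|X_ n w| <= M) ->
  (forall w, X_ n w @[n --> \oo] --> X w) ->
  (forall n, `|\int[P]_w X_ n w| <= C) -> `|\int[P]_w X w| <= C.
Proof.
move=> mX XM cX XC.
have c2 : `|\int[P]_w X_ n w| @[n --> \oo] --> `|\int[P]_w X w|.
  by apply: cvg_norm; exact: bounded_cvg mX XM cX.
by apply: (cvgr_to_le c2); exact: nearW.
Qed.

Lemma bounded_has_mean X (M : R) : measurable_fun setT X ->
  (forall w, `|X w| <= M) -> has_mean X (\int[P]_w X w).
Proof.
move=> mX XM; exists X; split => //; first exact: aeW.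
rewrite fineK//; apply: integrable_fin_num => //; exact: bounded_integrable XM.
Qed.

End bounded_variables.

Section freezing.
Context {R : realType} {d dS : measure_display}.
Context {Omega : measurableType d} {S : measurableType dS}.
Variable P : probability Omega R.
Variable N : probability (measurableTypeR R) R.
Variables (Phi : Omega -> S) (Y : Omega -> R).
Hypothesis mPhi : measurable_fun setT Phi.
Hypothesis mY : measurable_fun setT Y.

(** An independent variable may be integrated out with the rest of the
    randomness frozen. *)
Lemma freezing_bound (H : S * measurableTypeR R -> R) (M C : R) :
  (forall A B, measurable A -> measurable B ->
    P (Phi @^-1` A `&` Y @^-1` B) = (P (Phi @^-1` A) * N B)%E) ->
  measurable_fun setT H -> (forall z, `|H z| <= M) ->
  (forall s, `|\int[N]_y H (s, y)| <= C) ->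
  `|\int[P]_w H (Phi w, Y w)| <= C.
Proof.
move=> ind mH HM HC.
pose phi := fun w => (Phi w, Y w : measurableTypeR R).
have mphi : measurable_fun setT phi by exact: measurable_fun_pair.
pose Phi' : {RV P >-> S} := mfun_Sub (mem_set mPhi).
pose phi' : {RV P >-> (S * measurableTypeR R)%type} := mfun_Sub (mem_set mphi).
have prodE X : measurable X ->
    (distribution P Phi' \x N)%E X = distribution P phi' X.
  apply: product_measure_unique => A B mA mB.
  exact: ind.
have mEH : measurable_fun setT (EFin \o H) by exact/measurable_EFinP.
have iH : (distribution P Phi' \x N)%E.-integrable setT (EFin \o H).
  exact: bounded_integrable.
have -> : \int[P]_w H (Phi w, Y w) =
    fine (\int[distribution P Phi' \x N]_z (H z)%:E)%E.
  congr fine; rewrite (eq_measure_integral (distribution P phi')); last first.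
    by move=> A mA _; exact: prodE.
  rewrite integral_distribution//.
  by apply: bounded_integrable (fun w => HM (phi w)) => //; exact: measurableT_comp.
rewrite -integral12_prod_meas1//.
have eF s : (\int[N]_y (H (s, y))%:E)%E = (\int[N]_y H (s, y))%:E.
  rewrite fineK//; apply: integrable_fin_num => //.
  apply: bounded_integrable (fun y => HM (s, y)).
  by apply: (measurableT_comp mH); exact: measurable_pair1.
rewrite /fubini_F; under eq_integral do rewrite eF.
have mF : measurable_fun setT (fun s => \int[N]_y H (s, y)).
  apply/measurable_EFinP; rewrite (_ : _ \o _ = fubini_F N (EFin \o H)).
    exact: measurable_fubini_F iH.
  by apply/funext => s /=; rewrite /fubini_F eF.
apply: le_trans (le_normr_Rintegral _ _) _ => //.
  exact: (@bounded_integrable _ _ _ (distribution P Phi') _ C mF HC).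
have -> : C = \int[distribution P Phi']_s C.
  rewrite (Rintegral_cst (distribution P Phi') measurableT).
  rewrite -[LHS]mulr1; congr (_ * _); rewrite -[LHS]/(fine 1%E); congr fine.
  exact/esym/probability_setT.
apply: le_Rintegral => //.
- apply: (integrable_abse (f := EFin \o _)) => //.
  exact: (@bounded_integrable _ _ _ (distribution P Phi') _ C mF HC).
- exact: finite_measure_integrable_cst.
Qed.

End freezing.

(** * One step of the killed process *)

Section increments.
Context {R : realType} {d : measure_display} {Omega : measurableType d}.
Variable P : probability Omega R.
Variable B : R -> {RV P >-> R}.
Hypothesis hB : standard_brownian_motion B.
Variables (q : nat -> R) (N : nat).
Hypothesis q0 : 0 <= q 0%N.
Hypothesis ndq : nondecreasing_seq q.

Definition increment (i : nat) (w : Omega) : R := B (q i.+1) w - B (q i) w.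

(** A pi-system generating the past, the sigma-algebra of the first [N]
    increments. The value at time [q 0] is left out, since independence is
    assumed of the increments only. *)
Definition past_cylinders : set (set Omega) :=
  [set D | exists2 A : nat -> set R, (forall i, measurable (A i)) &
     D = \bigcap_(i in `I_N) (increment i @^-1` A i)].

Notation past := (g_sigma_algebraType past_cylinders).

Let mincr i : measurable_fun setT (increment i).
Proof. exact: measurable_funB. Qed.

Lemma increments_productE n (A : nat -> set R) : (forall i, measurable (A i)) ->
  P (\bigcap_(i in `I_n) (increment i @^-1` A i)) =
  (\prod_(i < n) P (increment i @^-1` A i))%E.
Proof.
move=> mA; rewrite -(bm_indep hB q0 ndq (A := fun i : 'I_n => A i))//.
congr (P _); apply/seteqP; split => w /= h i.
- by move=> _; exact: (h i (ltn_ord i)).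
- by move=> /= iN; exact: (h (Ordinal iN) I).
Qed.

Lemma past_cylinders_measurable : past_cylinders `<=` measurable.
Proof.
move=> _ [A mA ->]; apply: fin_bigcap_measurable; first exact: finite_II.
by move=> i _; rewrite -[X in measurable X]setTI; exact: mincr.
Qed.

Lemma past_cylinders_setI : setI_closed past_cylinders.
Proof.
move=> _ _ [A mA ->] [A' mA' ->]; exists (fun i => A i `&` A' i).
  by move=> i; exact: measurableI.
by rewrite -bigcapI; apply: eq_bigcapr => i _; rewrite preimage_setI.
Qed.

Lemma past_cylinders_setT : past_cylinders setT.
Proof.
exists (fun=> setT) => //.
by apply/seteqP; split => w.
Qed.

Lemma past_measurable (D : set Omega) : <<s past_cylinders >> D -> measurable D.
Proof.
apply: smallest_sub; last exact: past_cylinders_measurable.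
exact: sigma_algebra_measurable.
Qed.

(** As functions of [D], both sides are finite measures, and they agree on the
    cylinders. *)
Lemma past_independent (D : set Omega) (A : set R) :
  <<s past_cylinders >> D -> measurable A ->
  P (D `&` increment N @^-1` A) = (P D * P (increment N @^-1` A))%E.
Proof.
move=> sD mA.
have mYA : measurable (increment N @^-1` A).
  by rewrite -[X in measurable X]setTI; exact: mincr.
have c0 : 0 <= fine (P (increment N @^-1` A)) by exact: fine_ge0.
have cE : P (increment N @^-1` A) = (fine (P (increment N @^-1` A)))%:E.
  by rewrite fineK// fin_num_measure.
pose m1 : {measure set Omega -> \bar R} := mrestr P mYA.
pose m2 : {measure set Omega -> \bar R} := mscale (NngNum c0) P.
suff : m1 D = m2 D by rewrite /m1 /m2 /= /mrestr /mscale /= -cE muleC.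
apply: (g_sigma_algebra_measure_unique past_cylinders past_cylinders_measurable
  (fun=> setT)) => //.
- by move=> _; exact: past_cylinders_setT.
- by rewrite bigcup_const.
- exact: past_cylinders_setI.
- move=> _ [A' mA' ->]; rewrite /m1 /m2 /= /mrestr /mscale /= -cE.
  pose A2 i := if (i < N)%N then A' i else A.
  have mA2 i : measurable (A2 i) by rewrite /A2; case: ifP.
  have -> : \bigcap_(i in `I_N) increment i @^-1` A' i `&` increment N @^-1` A =
      \bigcap_(i in `I_N.+1) (increment i @^-1` A2 i).
    apply/seteqP; split => w /=.
    + move=> [h1 h2] i /=; rewrite ltnS leq_eqVlt => /predU1P[->|iN].
        by rewrite /A2 ltnn.
      by rewrite /A2 iN; exact: h1.
    + move=> h; split => [i /= iN|].
        by have := h i (ltnW iN); rewrite /A2 /= iN.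
      by have := h N (ltnSn N); rewrite /A2 /= ltnn.
  rewrite !increments_productE// big_ord_recr/= {2}/A2 ltnn muleC; congr (_ * _)%E.
  by apply: eq_bigr => i _; rewrite /A2 ltn_ord.
- by move=> k; rewrite /m1 /= /mrestr setTI (le_lt_trans (probability_le1 _ mYA))// ltry.
Qed.

Lemma past_increment i : (i < N)%N ->
  measurable_fun setT (increment i : past -> R).
Proof.
move=> iN _ A mA; rewrite setTI; apply: sub_sigma_algebra.
exists (fun j => if j == i then A else setT).
  by move=> j; case: ifP.
apply/seteqP; split => w /=.
- by move=> h j _ /=; case: eqP => // ->.
- by move=> h; have := h i iN; rewrite /= eqxx.
Qed.

Lemma past_position i : (i <= N)%N ->
  measurable_fun setT ((fun w => B (q i) w - B (q 0%N) w) : past -> R).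
Proof.
elim: i => [_|i IH iN].
  rewrite (_ : (fun w => _) = cst 0); first exact: measurable_cst.
  by apply/funext => w; rewrite subrr.
rewrite (_ : (fun w => _) =
    (fun w => (B (q i) w - B (q 0%N) w) + increment i w)); last first.
  by apply/funext => w; rewrite /increment; ring.
apply: measurable_funD; first exact: (IH (ltnW iN)).
exact: past_increment.
Qed.

Section one_step.
Variables (h c K Mu MV : R) (u u1 V : R -> R) (Z X : past -> R).
Hypotheses (h0 : 0 < h) (h1 : h <= 1) (qN : q N.+1 = q N + h).
Hypotheses (mu : measurable_fun setT u) (mV : measurable_fun setT V).
Hypotheses (uM : forall x, `|u x| <= Mu) (V0 : forall x, 0 <= V x).
Hypothesis VM : forall x, V x <= MV.
Hypothesis taylor : forall x z, x < c ->
  `|u (x + z) - u x - u1 x * z - V x * u x * z ^+ 2| <= K * `|z| ^+ 3.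
Hypotheses (mZ : measurable_fun setT Z) (mX : measurable_fun setT X).
Hypotheses (Z0 : forall w, 0 <= Z w <= 1) (ZX : forall w, Z w != 0 -> X w < c).

(** The drift of [exp(-h V) u] cancels to second order when [u'' = 2 V u];
    what remains is the third-order Taylor term, of size [h * sqrt h]. *)
Lemma one_step :
  `|\int[P]_w (Z w * (expR (- (h * V (X w))) * u (X w + increment N w) - u (X w)))|
  <= (256 * K + Mu * MV ^+ 2) * (h * Num.sqrt h).
Proof.
have Mu0 : 0 <= Mu by apply: le_trans (uM 0); exact: normr_ge0.
have MV0 : 0 <= MV by apply: le_trans (VM 0).
have sh0 : 0 < Num.sqrt h by rewrite sqrtr_gt0.
have hh : Num.sqrt h ^+ 2 = h by rewrite sqr_sqrtr// ltW.
have e01 s : 0 <= expR (- (h * V (X s))) <= 1.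
  by rewrite expR_ge0/= -expR0 ler_expR oppr_le0 mulr_ge0// ltW.
pose H (z : past * measurableTypeR R) : R :=
  Z z.1 * (expR (- (h * V (X z.1))) * u (X z.1 + z.2) - u (X z.1)).
apply: (@freezing_bound _ _ _ _ past P (normal_prob 0 (Num.sqrt h)) id
  (increment N) _ _ H (2 * Mu)).
- by move=> _ A mA; rewrite setTI; exact: past_measurable.
- exact: mincr.
- move=> A A' mA mA'; rewrite preimage_id past_independent//.
  congr (_ * _)%E; have q0N : 0 <= q N by apply: (le_trans q0); exact: ndq.
  have ltq : q N < q N.+1 by rewrite qN ltrDl.
  have -> : h = q N.+1 - q N by rewrite qN addrAC subrr add0r.
  exact: (bm_gauss hB q0N ltq mA').
- have m1 : measurable_fun setT (fun z : past * measurableTypeR R => X z.1).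
    exact: measurableT_comp.
  have m2 : measurable_fun setT (fun z : past * measurableTypeR R => Z z.1).
    exact: measurableT_comp.
  apply: measurable_funM => //; apply: measurable_funB; last exact: measurableT_comp.
  apply: measurable_funM; last first.
    by apply: (measurableT_comp mu); exact: measurable_funD.
  apply: measurableT_comp => //; apply: measurableT_comp => //.
  by apply: measurable_funM => //; exact: measurableT_comp.
- move=> [s y]; rewrite /H /= normrM.
  have /andP[z0 z1] := Z0 s; rewrite (ger0_norm z0).
  apply: (@le_trans _ _ (1 * (2 * Mu))); last by rewrite mul1r.
  apply: ler_pM => //; apply: (le_trans (ler_normB _ _)).
  have -> : 2 * Mu = 1 * Mu + Mu by ring.
  apply: lerD => //; rewrite normrM ger0_norm ?expR_ge0//.
  by apply: ler_pM => //; have /andP[] := e01 s.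
- move=> s; rewrite /H /=.
  set x := X s; set e := expR _ in e01 *.
  have K0 : 0 <= K.
    have := @taylor (c - 1) 1; rewrite ltrBlDr ltrDl normr1 !expr1n !mulr1 => /(_ ltr01).
    by apply: le_trans; exact: normr_ge0.
  have hs : 0 < h * Num.sqrt h by rewrite mulr_gt0.
  have C0 : 0 <= (256 * K + Mu * MV ^+ 2) * (h * Num.sqrt h).
    have K1 : 0 <= 256 * K by rewrite mulr_ge0.
    exact: (mulr_ge0 (addr_ge0 K1 (mulr_ge0 Mu0 (sqr_ge0 MV))) (ltW hs)).
  have mux : measurable_fun setT (fun y => u (x + y)).
    by apply: (measurableT_comp mu); exact: measurable_funD.
  pose Nh := normal_prob 0 (Num.sqrt h).
  have iux : Nh.-integrable setT (EFin \o (fun y => u (x + y))).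
    exact: (@bounded_integrable _ _ _ Nh _ Mu).
  have icst k : Nh.-integrable setT (EFin \o cst k).
    exact: finite_measure_integrable_cst.
  have iue : Nh.-integrable setT (EFin \o (fun y => e * u (x + y))).
    rewrite (_ : _ \o _ = (fun y => e%:E * (u (x + y))%:E)%E)//.
    exact: integrableZl.
  have iuB : Nh.-integrable setT (EFin \o (fun y => e * u (x + y) - u x)).
    rewrite (_ : _ \o _ = (EFin \o (fun y => (e * u (x + y))%R)) \- (EFin \o cst (u x)))%E//.
    exact: integrableB.
  rewrite RintegralZl// RintegralB//; last exact: (icst (u x)).
  rewrite RintegralZl// (Rintegral_cst Nh measurableT (u x)).
  rewrite (_ : fine (Nh setT) = 1) ?mulr1; last first.
    by rewrite -[RHS]/(fine 1%E); congr fine; exact: probability_setT.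
  have /andP[z0 z1] := Z0 s; have [->|Zs] := eqVneq (Z s) 0.
    by rewrite mul0r normr0; exact: C0.
  have xc : x < c by exact: ZX.
  have Kx z : `|u (x + z) - u (x + 0) - u1 x * z - V x * u x * z ^+ 2| <= K * `|z| ^+ 3.
    by rewrite addr0; exact: taylor.
  have := @normal_taylor _ _ sh0 (fun y => u (x + y)) (u1 x) (V x * u x) K mux
     (ex_intro _ Mu (fun z => uM (x + z))) Kx.
  rewrite hh addr0 exprSr hh -/Nh.
  set I := \int[Nh]_y u (x + y) => hI.
  have hV0 : 0 <= h * V x by rewrite mulr_ge0// ltW.
  have /andP[e0 e1] := e01 s.
  have e_lo : 1 - h * V x <= e.
    by rewrite /e; have := expR_ge1Dx (- (h * V x)).
  have e_hi : e * (1 + h * V x) <= 1.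
    apply: (@le_trans _ _ (e * expR (h * V x))); last by rewrite /e -expRD addNr expR0.
    by rewrite ler_wpM2l// expR_ge1Dx.
  have b1 : `|e * (1 + h * V x) - 1| <= (h * V x) ^+ 2.
    rewrite ler_norml; apply/andP; split; last first.
      by apply: (@le_trans _ _ 0); [rewrite subr_le0|exact: sqr_ge0].
    nra.
  have hh2 : (h * V x) ^+ 2 <= MV ^+ 2 * (h * Num.sqrt h).
    rewrite exprMn mulrC; apply: ler_pM; rewrite ?sqr_ge0//.
      by rewrite lerXn2r ?nnegrE.
    rewrite expr2 ler_pM2l// -{1}hh expr2 -[leRHS]mul1r ler_pM2r//.
    by rewrite -sqrtr1 ler_wsqrtr.
  rewrite normrM (ger0_norm z0) -[leRHS]mul1r.
  apply: ler_pM => //.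
  have -> : e * I - u x = e * (I - u x - V x * u x * h) + u x * (e * (1 + h * V x) - 1).
    by ring.
  apply: (le_trans (ler_normD _ _)); rewrite mulrDl; apply: lerD.
    rewrite normrM (ger0_norm e0) -mulrA -[leRHS]mul1r mulrA.
    by apply: ler_pM => //; rewrite mulr1 mulrA.
  rewrite normrM -[leRHS]mulrA; apply: ler_pM => //.
  exact: le_trans hh2.
Qed.
End one_step.
End increments.

(** * Discretisation of a continuous path *)

Section paths.
Context {R : realType}.
Notation mu := (@lebesgue_measure R).
Implicit Types (g beta u : R -> R) (c e T rho : R).

(** The point [y] is allowed to leave [[0, T]] because the last step of a grid
    may overshoot the horizon. *)
Lemma continuous_modulus g T e : continuous g -> 0 < e ->
  exists2 delta : R, 0 < delta &
    forall x y, 0 <= x <= T -> `|x - y| < delta -> `|g x - g y| <= e.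
Proof.
move=> cg e0.
have /compact_near_coveringP cov := @segment_compact R 0 T.
pose Q (i x : R) := forall y, `|x - y| < i -> `|g x - g y| <= e.
have : \forall i \near (0:R)^'+, `[0, T] `<=` Q i.
  apply: cov => x _.
  have /nbhs_ballP[r /= r0 hr] : \forall t \near x, `|g x - g t| < e / 2.
    by have /cvgrPdist_lt := cg x; apply; exact: divr_gt0.
  have r2 : 0 < r / 2 by rewrite divr_gt0.
  exists (ball x (r / 2), [set i : R | i < r / 2]).
    by split; [exact: nbhsx_ballx|exact: nbhs_right_lt].
  move=> [x' i] [/= xx' ir] y x'y.
  have h1 := hr x' (le_ball (ltW (_ : r / 2 < r)) xx').
  have h2 : ball x r y.
    rewrite /ball /=; rewrite /ball /= in xx'.
    rewrite (_ : x - y = (x - x') + (x' - y)); last by ring.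
    apply: le_lt_trans (ler_normD _ _) _.
    rewrite [ltRHS](_ : r = r / 2 + r / 2); last by field.
    by apply: ltrD => //; exact: lt_trans ir.
  have {}h1 : `|g x - g x'| < e / 2 by apply: h1; lra.
  have {}h2 := hr y h2.
  rewrite (_ : g x' - g y = - (g x - g x') + (g x - g y)); last by ring.
  apply: le_trans (ler_normD _ _) _; rewrite normrN; move: h1 h2 => /=; lra.
move=> /nbhs_right0P [r /= r0 hr].
exists (r / 2); first by rewrite divr_gt0.
move=> x y x0T xy; apply: (hr (r / 2)) => //=.
- by rewrite /ball/= sub0r normrN gtr0_norm ?divr_gt0//; lra.
- by rewrite divr_gt0.
- by rewrite add0r.
Qed.

Lemma integral_mean_value g (x y : R) : continuous g -> 0 <= x -> x <= y ->
  exists2 z, x <= z <= y &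
    \int[mu]_(t in `[0, y]) g t - \int[mu]_(t in `[0, x]) g t = g z * (y - x).
Proof.
move=> cg x0 xy.
have ig (z : R) : mu.-integrable `[0, z] (EFin \o g).
  apply: continuous_compact_integrable; first exact: segment_compact.
  exact: continuous_subspaceT.
have y0 : 0 <= y by exact: le_trans xy.
have [z| |z zxy ->] := @MVT_segment _ (fun z => \int[mu]_(t in `[0, z]) g t) g x y xy.
- rewrite in_itv /= => /andP[xz zy].
  have z0 : 0 < z by exact: le_lt_trans xz.
  have zz1 : z < z + 1 by rewrite ltrDl.
  have [d1 d2] := @continuous_FTC1_closed _ g 0 z (z + 1) zz1
    (ig _) z0 (cg z).
  by apply: DeriveDef; [exact: d1|rewrite -derive1E; exact: d2].
- apply: (@continuous_subspaceW _ _ _ `[0, y]).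
    by apply: subset_itvr; rewrite bnd_simp.
  exact: parameterized_integral_continuous.
- by exists z.
Qed.

Lemma riemann_sum_error g (h e T : R) (k : nat) : continuous g -> 0 < h ->
  (forall x y, 0 <= x <= T -> `|x - y| <= h -> `|g x - g y| <= e) ->
  k%:R * h <= T ->
  `|\sum_(j < k) h * g (j%:R * h) - \int[mu]_(t in `[0, k%:R * h]) g t| <= k%:R * h * e.
Proof.
move=> cg h0 he; elim: k => [_|k IH kT].
  by rewrite big_ord0 !mul0r set_itv1 Rintegral_set1 subr0 normr0.
have kk : k%:R * h <= k.+1%:R * h by rewrite ler_pM2r// ler_nat.
have k0 : 0 <= k%:R * h by rewrite mulr_ge0// ltW.
have {}IH := IH (le_trans kk kT).
have [z /andP[z1 z2] zE] := integral_mean_value cg k0 kk.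
have hE : k.+1%:R * h - k%:R * h = h by rewrite -natr1; ring.
rewrite hE in zE.
rewrite big_ord_recr /=.
have -> : \sum_(i < k) h * g (i%:R * h) + h * g (k%:R * h) -
    \int[mu]_(t in `[0, k.+1%:R * h]) g t =
   (\sum_(i < k) h * g (i%:R * h) - \int[mu]_(t in `[0, k%:R * h]) g t) +
   h * (g (k%:R * h) - g z).
  by rewrite mulrBr (mulrC h (g z)) -zE; ring.
apply: le_trans (ler_normD _ _) _.
have -> : k.+1%:R * h * e = k%:R * h * e + h * e by rewrite -natr1; ring.
apply: lerD => //; rewrite normrM gtr0_norm// ler_pM2l//.
apply: he; first by rewrite k0 (le_trans kk kT).
rewrite distrC ger0_norm ?subr_ge0//.
by rewrite lerBlDl (le_trans z2)// -natr1 mulrDl mul1r.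
Qed.

Definition dyadic (n k : nat) : R := k%:R / (2 ^ n)%:R.

Lemma dyadic_refine n l k : dyadic (n + l) (k * 2 ^ l) = dyadic n k.
Proof.
rewrite /dyadic natrM expnD natrM invfM mulrACA divff ?mulr1// pnatr_eq0 expn_eq0.
Qed.

Lemma dyadic_ge0 n k : 0 <= dyadic n k.
Proof. by rewrite /dyadic divr_ge0. Qed.

Lemma ler_dyadic n : {mono (dyadic n) : k j / (k <= j)%N >-> k <= j}.
Proof.
by move=> k j; rewrite /dyadic ler_pM2r ?ler_nat// invr_gt0 ltr0n expn_gt0.
Qed.

Lemma mesh_gt0 n : 0 < (2 ^ n)%:R^-1 :> R.
Proof. by rewrite invr_gt0 ltr0n expn_gt0. Qed.

Lemma cvg_mesh : ((2 ^ n)%:R^-1 : R) @[n --> \oo] --> (0 : R).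
Proof.
rewrite (_ : (fun n => _) = (fun n => (2^-1 : R) ^+ n)); last first.
  by apply/funext => n; rewrite natrX exprVn.
by apply: cvg_expr; rewrite ger0_norm ?invr_ge0// invf_lt1 ?ltr1n.
Qed.

(** A countable description of a continuous path that stays strictly below [c]
    on [[0, dyadic n k]]: by compactness it keeps a distance [1 / (m + 1)] from
    [c], which can be tested on the dyadic times of all orders. *)
Definition dyadic_below beta c n k : Prop := exists m : nat,
  forall l j, (j <= k * 2 ^ l)%N -> beta (dyadic (n + l) j) <= c - m.+1%:R^-1.

Lemma dyadic_belowP beta c n k : continuous beta ->
  dyadic_below beta c n k <-> (forall t, 0 <= t <= dyadic n k -> beta t < c).
Proof.
move=> cb; split => [[m hm] t /andP[t0 tk]|H].
- apply: (@le_lt_trans _ _ (c - m.+1%:R^-1)); last first.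
    by rewrite ltrBlDr ltrDl invr_gt0 ltr0n.
  pose x l := dyadic (n + l) (Num.trunc (t * (2 ^ (n + l))%:R)).
  have x_t l : x l <= t < x l + (2 ^ (n + l))%:R^-1.
    have p0 : 0 < (2 ^ (n + l))%:R :> R by rewrite ltr0n expn_gt0.
    have := @truncn_itv _ (t * (2 ^ (n + l))%:R).
    rewrite mulr_ge0 ?(ltW p0)// => /(_ isT) /andP[h1 h2].
    rewrite /x /dyadic ler_pdivrMr// h1/= -[X in _ < _ + X]mul1r -mulrDl.
    by rewrite natr1 ltr_pdivlMr.
  have cx : x l @[l --> \oo] --> t.
    have c0 : (fun l => t - (2 ^ (n + l))%:R^-1) l @[l --> \oo] --> t.
      rewrite -[X in _ --> X](subr0 t); apply: cvgB; first exact: cvg_cst.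
      rewrite (_ : (fun l => _) = (fun l => (2 ^ n)%:R^-1 * ((2 ^ l)%:R^-1 : R))).
        by rewrite -(mulr0 (2 ^ n)%:R^-1); apply: cvgM; [exact: cvg_cst|exact: cvg_mesh].
      by apply/funext => l; rewrite expnD natrM invfM.
    apply: (squeeze_cvgr _ c0 (cvg_cst t)); apply: nearW => l.
    by have /andP[h1 h2] := x_t l; rewrite h1 andbT lerBlDr ltW.
  apply: (cvgr_to_le (cvg_comp _ _ cx (cb t))); apply: nearW => l /=.
  apply: hm; rewrite -(ler_dyadic (n + l)) dyadic_refine.
  by have /andP[h1 _] := x_t l; exact: le_trans tk.
- have k0 := dyadic_ge0 n k.
  have [z z0k hz] := EVT_max k0 (continuous_subspaceT cb).
  have zc : beta z < c by apply: H; rewrite in_itv/= in z0k.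
  have cz : 0 < c - beta z by rewrite subr_gt0.
  exists (Num.trunc (c - beta z)^-1) => l j jk.
  apply: (@le_trans _ _ (beta z)).
    by apply: hz; rewrite in_itv/= dyadic_ge0/= -(dyadic_refine n l) ler_dyadic.
  rewrite lerBrDl -lerBrDr -[leRHS]invrK lef_pV2 ?posrE ?ltr0n ?invr_gt0//.
  have := @truncn_itv _ (c - beta z)^-1.
  by rewrite invr_ge0 ltW// => /(_ isT) /andP[_ /ltW].
Qed.

(** [rho] is the first passage of [beta] at level [c], or [T] if that is
    earlier. *)
Definition stopped_at c T beta rho : Prop :=
  [/\ 0 <= rho <= T, forall t, 0 <= t -> t < rho -> beta t < c &
      rho = T \/ c <= beta rho].

(** The value of [exp(- int_0^t g) u(beta_t)] at time [t = k / 2^n], with a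
    Riemann sum in place of the integral. *)
Definition killed (u g beta : R -> R) n k : R :=
  expR (- \sum_(j < k) (2 ^ n)%:R^-1 * g (dyadic n j)) * u (beta (dyadic n k)).

(** [G n] collects the increments of the killed process over the dyadic steps
    that begin before the passage [rho]. The sum telescopes up to the first
    dyadic time at or after [rho], and this time tends to [rho]. *)
Lemma killed_stopped_cvg u g beta c rho (M : R) (T : nat) :
  continuous u -> continuous g -> continuous beta ->
  (forall t, `|g t| <= M) -> stopped_at c T%:R beta rho ->
  let G n := killed u g beta n 0%N +
    \sum_(k < T * 2 ^ n) `[< dyadic_below beta c n k >]%:R *
      (killed u g beta n k.+1 - killed u g beta n k) in
  (forall n, exists k, G n = killed u g beta n k) /\
  G n @[n --> \oo] --> expR (- \int[mu]_(t in `[0, rho]) g t) * u (beta rho).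
Proof.
move=> cu cg cb gM [/andP[r0 rT] rbelow rend] /=.
have exk n : exists k, rho <= dyadic n k.
  exists (T * 2 ^ n)%N; rewrite -[n]add0n dyadic_refine /dyadic expn0 divr1.
  exact: rT.
(* the first dyadic time at or after [rho] is [kap n / 2 ^ n] *)
pose kap n := ex_minn (exk n).
have kapP n k : (k < kap n)%N = (dyadic n k < rho).
  rewrite /kap; case: ex_minnP => m hm hmin.
  apply/idP/idP => [km|kr]; first by rewrite ltNge; apply/negP => /hmin; rewrite leqNgt km.
  rewrite ltnNge; apply/negP => mk.
  by have := lt_le_trans kr (le_trans hm (_ : _ <= dyadic n k)); rewrite ltxx ler_dyadic => /(_ mk).
have kapT n : (kap n <= T * 2 ^ n)%N.
  rewrite leqNgt kapP -[n]add0n dyadic_refine /dyadic expn0 divr1 -leNgt.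
  by [].
have kap_ge n : rho <= dyadic n (kap n) by rewrite leNgt -kapP ltnn.
have kap_le n : dyadic n (kap n) <= rho + (2 ^ n)%:R^-1.
  case E : (kap n) => [|k].
    by rewrite /dyadic mul0r addr_ge0// ltW// mesh_gt0.
  have := kapP n k; rewrite E ltnSn => /esym /ltW kr.
  by rewrite /dyadic -natr1 mulrDl mul1r lerD2r.
have GE n : killed u g beta n 0%N + \sum_(k < T * 2 ^ n) `[< dyadic_below beta c n k >]%:R *
    (killed u g beta n k.+1 - killed u g beta n k) = killed u g beta n (kap n).
  have belowE k : (k < T * 2 ^ n)%N -> `[< dyadic_below beta c n k >] = (k < kap n)%N.
    move=> kT; rewrite kapP; apply/asboolP/idP.
    - move/(dyadic_belowP c n k cb) => h; rewrite ltNge; apply/negP => rk.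
      case: rend => [rE|crho].
        have : dyadic n k < T%:R.
          by rewrite /dyadic ltr_pdivrMr ?ltr0n ?expn_gt0// -natrM ltr_nat.
        by rewrite -rE ltNge rk.
      by have := h rho; rewrite r0 rk ltNge crho => /(_ isT).
    - move=> kr; apply/(dyadic_belowP c n k cb) => t /andP[t0 tk].
      by apply: rbelow => //; exact: le_lt_trans kr.
  under eq_bigr => k _ do rewrite belowE//.
  rewrite -[RHS](subrK (killed u g beta n 0)) addrC; congr (_ + _).
  rewrite -(telescope_sumr (killed u g beta n) (leq0n (kap n))) big_mkord.
  rewrite (big_ord_widen _ (fun k => killed u g beta n k.+1 - killed u g beta n k) (kapT n)).
  rewrite [RHS]big_mkcond; apply: eq_bigr => k _.
  by case: ifP; rewrite ?mul1r ?mul0r.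
split; first by move=> n; exists (kap n); exact: GE.
under eq_fun do rewrite GE.
have ckap : dyadic n (kap n) @[n --> \oo] --> rho.
  apply: (@squeeze_cvgr _ _ _ _ (fun=> rho) (fun n => rho + (2 ^ n)%:R^-1)).
  - by apply: nearW => n; rewrite kap_ge kap_le.
  - exact: cvg_cst.
  - rewrite -[X in _ --> X]addr0; apply: cvgD; [exact: cvg_cst|exact: cvg_mesh].
apply: cvgM; last first.
  exact: (cvg_comp _ _ (cvg_comp _ _ ckap (cb rho)) (cu (beta rho))).
apply: (@cvg_comp _ _ _
  (fun n => - \sum_(j < kap n) (2 ^ n)%:R^-1 * g (dyadic n j)) expR
  _ _ _ _ (@continuous_expR R _)).
apply: cvgN.
apply/cvgrPdist_le => e e0.
have M0 : 0 <= M by apply: le_trans (gM 0); exact: normr_ge0.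
pose e1 := e / (2 * (T.+1)%:R).
have e10 : 0 < e1 by rewrite divr_gt0// mulr_gt0.
have [delta d0 hd] := continuous_modulus T.+1%:R cg e10.
near=> n.
have mn : (2 ^ n)%:R^-1 < delta by near: n; exact: (cvgr_lt _ cvg_mesh).
have mM : (2 ^ n)%:R^-1 * M <= e / 2.
  near: n.
  have : ((2 ^ n)%:R^-1 * M) @[n --> \oo] --> (0 : R).
    by rewrite -(mul0r M); apply: cvgM; [exact: cvg_mesh|exact: cvg_cst].
  move=> h; apply: (cvgr_le _ h); exact: divr_gt0.
have m1 : (2 ^ n)%:R^-1 <= 1 :> R.
  by rewrite invf_le1 ?ler1n ?expn_gt0// ltr0n expn_gt0.
have kT : (kap n)%:R * (2 ^ n)%:R^-1 <= T.+1%:R :> R.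
  by apply: le_trans (kap_le n) _; rewrite -natr1; apply: lerD.
have hS : `|\sum_(j < kap n) (2 ^ n)%:R^-1 * g (dyadic n j) -
    \int[mu]_(t in `[0, dyadic n (kap n)]) g t| <= dyadic n (kap n) * e1.
  exact: (riemann_sum_error cg (mesh_gt0 n)
  (fun x y xT xy => hd x y xT (le_lt_trans xy mn)) kT).
have [z /andP[z1 z2]] := integral_mean_value cg r0 (kap_ge n).
move: hS; set S := \sum_(j < kap n) _; set I := \int[mu]_(t in `[0, dyadic n _]) _.
set J := \int[mu]_(t in `[0, rho]) _ => hS IJ.
rewrite (_ : J - S = - (S - I) - (I - J)); last by ring.
apply: le_trans (ler_normB _ _) _; rewrite normrN.
have b1 : `|S - I| <= e / 2.
  apply: le_trans hS _; apply: (@le_trans _ _ (T.+1%:R * e1)).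
    by rewrite ler_pM2r.
  have -> : e1 = e / 2 / T.+1%:R by rewrite /e1 invfM mulrA.
  by rewrite mulrC divfK// pnatr_eq0.
have b2 : `|I - J| <= e / 2.
  rewrite IJ normrM; apply: le_trans mM; rewrite mulrC.
  apply: ler_pM => //; rewrite ger0_norm ?subr_ge0//.
  by rewrite lerBlDl.
lra.
Unshelve. all: end_near. Qed.

End paths.

(** Lets paths on the half-line be handled as continuous functions on the whole
    line. *)
Lemma continuous_positive_part {R : realType} (f : R -> R) :
  {within `[0, +oo[, continuous f} -> continuous (fun t : R => f (Num.max t 0)).
Proof.
move=> /continuous_within_itvcyP[cf f0] t.
have [t0|t0|->] := ltgtP t 0.
- rewrite /continuous_at (max_idPr (ltW t0)).
  apply: cvg_near_cst; near=> x.
  have x0 : x < 0 by near: x; exact: lt_nbhsl.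
  by rewrite (max_idPr (ltW x0)).
- rewrite /continuous_at (max_idPl (ltW t0)).
  apply: cvg_trans (_ : f x @[x --> t] `=>` _); last first.
    by apply: cf; rewrite in_itv/= andbT.
  apply: near_eq_cvg; near=> x.
  have x0 : 0 < x by near: x; exact: lt_nbhsr.
  by rewrite (max_idPl (ltW x0)).
- rewrite /continuous_at maxxx; apply/cvgrPdist_lt => e e0.
  have /nbhs_right0P[r /= r0 hr] : \forall x \near (0:R)^'+, `|f 0 - f x| < e.
    by move/cvgrPdist_lt : f0; apply.
  near=> x; have [x0|x0] := leP x 0.
    by rewrite subrr normr0.
  rewrite -[x]add0r; apply: hr => //.
  rewrite /ball/= sub0r normrN.
  near: x; exact: (@nbhs0_lt R R _ r0).
Unshelve. all: end_near. Qed.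

(** * The discretised Feynman-Kac formula *)

Section feynman_kac.
Context {R : realType} {d : measure_display} {Omega : measurableType d}.
Variable P : probability Omega R.
Variable B : R -> {RV P >-> R}.
Hypothesis hB : standard_brownian_motion B.
Notation mu := (@lebesgue_measure R).
Variables (c K Mu MV : R) (u u1 V : R -> R).
Hypotheses (cu : continuous u) (cV : continuous V).
Hypotheses (uM : forall x, `|u x| <= Mu) (V0 : forall x, 0 <= V x).
Hypothesis VM : forall x, V x <= MV.
Hypothesis taylor : forall x z, x < c ->
  `|u (x + z) - u x - u1 x * z - V x * u x * z ^+ 2| <= K * `|z| ^+ 3.

(** Started exactly at the origin, unlike [B], which is so almost surely. *)
Let b t w := B t w - B 0 w.
Let M n k w := killed u (fun t => V (b t w)) (b ^~ w) n k.
Let C := (256 * K + Mu * MV ^+ 2).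

Let mb t : measurable_fun setT (b t).
Proof. exact: measurable_funB. Qed.

Let mu_ : measurable_fun setT u. Proof. exact: continuous_measurable_fun. Qed.
Let mV : measurable_fun setT V. Proof. exact: continuous_measurable_fun. Qed.

Let killed_le (be : R -> R) n k : `|killed u (V \o be) be n k| <= Mu.
Proof.
rewrite /killed normrM -[leRHS]mul1r; apply: ler_pM => //.
rewrite ger0_norm ?expR_ge0// -expR0 ler_expR oppr_le0 sumr_ge0// => j _.
by rewrite mulr_ge0 ?V0// ltW// mesh_gt0.
Qed.

Let mM n k : measurable_fun setT (M n k).
Proof.
apply: measurable_funM; last by apply: (measurableT_comp mu_); exact: mb.
apply: measurableT_comp => //; apply: measurableT_comp => //.
apply: measurable_sum => j; apply: measurable_funM => //.
by apply: (measurableT_comp mV); exact: mb.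
Qed.

Section grid.
Variables (n k : nat).
Let h : R := (2 ^ n)%:R^-1.

(** The times of order [n + l] up to [k / 2 ^ n], tested with the margin
    [1 / (m + 1)]; see [dyadic_below]. *)
Let grid l m : set Omega := [set w | forall j, (j <= k * 2 ^ l)%N ->
  b (dyadic (n + l) j) w <= c - m.+1%:R^-1].

Let gridE l m : grid l m = \bigcap_(j in `I_(k * 2 ^ l).+1)
  (b (dyadic (n + l) j) @^-1` `]-oo, c - m.+1%:R^-1]).
Proof.
apply/seteqP; split => w H j.
  by rewrite /= ltnS in_itv /= => jN; exact: H.
by move=> jN; have := H j; rewrite /= in_itv/= ltnS => /(_ jN).
Qed.

Let F w := M n k.+1 w - M n k w.

Let mF : measurable_fun setT F.
Proof. exact: measurable_funB. Qed.

Let FM w : `|F w| <= 2 * Mu.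
Proof.
rewrite (_ : 2 * Mu = Mu + Mu); last by ring.
by apply: le_trans (ler_normB _ _) _; apply: lerD; exact: killed_le.
Qed.

Let grid_step l m : `|\int[P]_w (\1_(grid l m) w * F w)| <= C * (h * Num.sqrt h).
Proof.
(* the fine grid, followed by one long step from [k / 2 ^ n] to
   [(k + 1) / 2 ^ n] *)
pose N := (k * 2 ^ l)%N.
pose q j : R := if (j <= N)%N then dyadic (n + l) j else dyadic n k + h.
have h0 : 0 < h by exact: mesh_gt0.
have h1 : h <= 1 by rewrite invf_le1 ?ler1n ?expn_gt0// ltr0n expn_gt0.
have qle j : (j <= N)%N -> q j = dyadic (n + l) j by rewrite /q => ->.
have qNE : q N = dyadic n k by rewrite qle// dyadic_refine.
have q00 : q 0%N = 0 by rewrite qle// /dyadic mul0r.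
have q0 : 0 <= q 0%N by rewrite q00.
have qSN : q N.+1 = q N + h by rewrite qNE /q ltnn.
have ndq : nondecreasing_seq q.
  move=> i j ij; rewrite /q; case: (leqP j N) => jN.
    by rewrite (leq_trans ij jN) ler_dyadic.
  case: (leqP i N) => iN //; rewrite -(dyadic_refine n l).
  by apply: (@le_trans _ _ (dyadic (n + l) N)); rewrite ?ler_dyadic// lerDl ltW.
have past_b j : (j <= N)%N ->
    measurable_fun setT (b (dyadic (n + l) j) : g_sigma_algebraType (past_cylinders B q N) -> R).
  move=> jN; rewrite /b -(qle _ jN) -q00.
  exact: past_position.
pose X w := b (dyadic n k) w.
pose A w := expR (- \sum_(j < k) h * V (b (dyadic n j) w)).
pose Z w := \1_(grid l m) w * A w.
have mgrid : (past_cylinders B q N).-sigma.-measurable (grid l m).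
  rewrite gridE.
  apply: fin_bigcap_measurable; first exact: finite_II.
  by move=> j /=; rewrite ltnS => jN; rewrite -[X in measurable X]setTI; exact: past_b.
have mX : measurable_fun setT (X : g_sigma_algebraType (past_cylinders B q N) -> R).
  by rewrite /X -(dyadic_refine n l); exact: past_b.
have mA : measurable_fun setT (A : g_sigma_algebraType (past_cylinders B q N) -> R).
  apply: measurableT_comp => //; apply: measurableT_comp => //.
  apply: measurable_sum => j; apply: measurable_funM => //.
  apply: (measurableT_comp mV); rewrite -(dyadic_refine n l).
  by apply: past_b; rewrite leq_mul2r (ltnW (ltn_ord j)) orbT.
have mZ : measurable_fun setT (Z : g_sigma_algebraType (past_cylinders B q N) -> R).
  by apply: measurable_funM => //; exact: measurable_indic.
have A01 w : 0 <= A w <= 1.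
  rewrite expR_ge0/= -expR0 ler_expR oppr_le0 sumr_ge0// => j _.
  by rewrite mulr_ge0 ?V0// ltW.
have Z0 w : 0 <= Z w <= 1.
  rewrite /Z indicE; case: (w \in _) => /=; first by rewrite mul1r A01.
  by rewrite mul0r lexx ler01.
have ZX w : Z w != 0 -> X w < c.
  rewrite /Z indicE; case: (boolP (w \in _)) => /=; last by rewrite mul0r eqxx.
  rewrite inE => H _; have := H N (leqnn N).
  rewrite dyadic_refine => /le_lt_trans; apply.
  by rewrite ltrBlDr ltrDl invr_gt0 ltr0n.
have := one_step hB q0 ndq h0 h1 qSN mu_ mV uM V0 VM taylor mZ mX Z0 ZX.
congr (_ <= _); congr `|_|; apply: eq_Rintegral => w _.
rewrite /Z /F /M /killed -/(A w) big_ord_recr/= opprD expRD -/(A w).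
have -> : b (dyadic n k.+1) w = X w + increment B q N w.
  rewrite /increment qSN qNE /X /b.
  have -> : dyadic n k + h = dyadic n k.+1 by rewrite /dyadic -natr1 mulrDl mul1r.
  by ring.
rewrite -/(X w) -/h; ring.
Qed.

Definition before_level : set Omega := [set w | dyadic_below (b ^~ w) c n k].

Let before_levelE : before_level = \bigcup_m \bigcap_l grid l m.
Proof.
apply/seteqP; split => w [m].
- by move=> H; exists m => // l _ j jk; exact: H.
- by move=> _ H; exists m => l j jk; exact: H.
Qed.

Let mgrid l m : measurable (grid l m).
Proof.
rewrite gridE.
apply: fin_bigcap_measurable; first exact: finite_II.
by move=> j _; rewrite -[X in measurable X]setTI; exact: mb.
Qed.

Lemma before_level_measurable : measurable before_level.
Proof.
rewrite before_levelE; apply: bigcupT_measurable => m.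
by apply: bigcapT_measurable => l; exact: mgrid.
Qed.

Let indF_le (D : set Omega) w : `|\1_D w * F w| <= 2 * Mu.
Proof.
rewrite normrM -[leRHS]mul1r; apply: ler_pM => //.
by rewrite indicE; case: (_ \in _); rewrite ?normr1 ?normr0.
Qed.

(** The event is an increasing union over [m] of decreasing intersections over
    [l] of events [grid l m] of the past. To each of these [one_step] applies,
    the indicator and the killing factor being frozen together. *)
Lemma before_level_step :
  `|\int[P]_w (\1_before_level w * (M n k.+1 w - M n k w))| <= C * (h * Num.sqrt h).
Proof.
apply: (@bounded_cvg_bound _ _ _ P
  (fun m w => \1_(\bigcap_l grid l m) w * F w) _ (2 * Mu)).
- move=> m; apply: measurable_funM => //; apply: measurable_indic.
  by apply: bigcapT_measurable => l; exact: mgrid.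
- by move=> m w; exact: indF_le.
- move=> w; apply: cvgM; last exact: cvg_cst.
  rewrite indicE; have [|] := boolP (w \in before_level).
    rewrite inE before_levelE => -[m _ H]; apply: cvg_near_cst.
    exists m => // m' /= mm'; rewrite indicE mem_set// => l _ j jk.
    apply: (le_trans (H l I j jk)).
    by rewrite lerD2l lerN2 lef_pV2 ?posrE ?ltr0n// ler_nat ltnS.
  rewrite notin_setE before_levelE => H; apply: cvg_near_cst.
  apply: nearW => m; rewrite indicE memNset// => H'; apply: H.
  by exists m.
move=> m; apply: (@bounded_cvg_bound _ _ _ P
  (fun l w => \1_(grid l m) w * F w) _ (2 * Mu)).
- by move=> l; apply: measurable_funM => //; exact: measurable_indic.
- by move=> l w; exact: indF_le.
- move=> w; apply: cvgM; last exact: cvg_cst.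
  rewrite indicE; have [|] := boolP (w \in \bigcap_l grid l m).
    rewrite inE => H; apply: cvg_near_cst; apply: nearW => l.
    by rewrite indicE mem_set//; exact: H.
  rewrite notin_setE => /existsNP[l /not_implyP[_ H]]; apply: cvg_near_cst.
  exists l => // l' /= ll'; rewrite indicE memNset// => H'; apply: H => j jk.
  rewrite -(dyadic_refine (n + l) (l' - l)) -addnA subnKC//; apply: H'.
  by rewrite -[X in (_ <= _ * 2 ^ X)%N](subnKC ll') expnD mulnA leq_mul2r jk orbT.
- by move=> l; exact: grid_step.
Qed.

End grid.

Let C0 : 0 <= C.
Proof.
have Mu0 : 0 <= Mu by apply: le_trans (uM 0); exact: normr_ge0.
have K0 : 0 <= K.
  have := @taylor (c - 1) 1; rewrite ltrBlDr ltrDl normr1 !expr1n !mulr1 => /(_ ltr01).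
  by apply: le_trans; exact: normr_ge0.
by rewrite /C; have := mulr_ge0 Mu0 (sqr_ge0 MV); lra.
Qed.

Section horizon.
Variable T : nat.

Let G n w := u 0 + \sum_(k < T * 2 ^ n) \1_(before_level n k) w * (M n k.+1 w - M n k w).

Let mG n : measurable_fun setT (G n).
Proof.
apply: measurable_funD => //; apply: measurable_sum => k.
apply: measurable_funM; last exact: measurable_funB.
by apply: measurable_indic; exact: before_level_measurable.
Qed.

(** There are [T * 2 ^ n] steps, each with an error of order [h * sqrt h], where
    [h = 2 ^- n]. *)
Let mean_G n : exists m, has_mean P (G n) m /\ `|m - u 0| <= T%:R * C * Num.sqrt (2 ^ n)%:R^-1.
Proof.
set h : R := (2 ^ n)%:R^-1.
have h0 : 0 < h by exact: mesh_gt0.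
pose S j w := \sum_(k < j) \1_(before_level n k) w * (M n k.+1 w - M n k w).
have mS j : measurable_fun setT (S j).
  apply: measurable_sum => k; apply: measurable_funM; last exact: measurable_funB.
  by apply: measurable_indic; exact: before_level_measurable.
have incr_le k w : `|\1_(before_level n k) w * (M n k.+1 w - M n k w)| <= 2 * Mu.
  rewrite normrM -[leRHS]mul1r; apply: ler_pM => //.
    by rewrite indicE; case: (_ \in _); rewrite ?normr1 ?normr0.
  rewrite (_ : 2 * Mu = Mu + Mu); last by ring.
  by apply: le_trans (ler_normB _ _) _; apply: lerD; exact: killed_le.
have S_le j w : `|S j w| <= j%:R * (2 * Mu).
  elim: j => [|j IH]; first by rewrite /S big_ord0 normr0 mul0r.
  rewrite /S big_ord_recr/= -natr1 mulrDl mul1r.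
  by apply: le_trans (ler_normD _ _) _; apply: lerD.
have ES j : `|\int[P]_w S j w| <= j%:R * (C * (h * Num.sqrt h)).
  elim: j => [|j IH].
    rewrite mul0r (_ : (fun w => _) = cst 0) ?Rintegral_cst ?mul0r ?normr0//.
    by apply/funext => w; rewrite /S big_ord0.
  rewrite (_ : (fun w => _) = (fun w => S j w +
      \1_(before_level n j) w * (M n j.+1 w - M n j w))); last first.
    by apply/funext => w; rewrite /S big_ord_recr.
  rewrite RintegralD//; last 2 first.
  - exact: (bounded_integrable _ (mS j) (S_le j)).
  - apply: (bounded_integrable _ _ (incr_le j)).
    apply: measurable_funM; last exact: measurable_funB.
    by apply: measurable_indic; exact: before_level_measurable.
  rewrite -natr1 mulrDl mul1r.
  by apply: le_trans (ler_normD _ _) _; apply: lerD => //; exact: before_level_step.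
have G_le w : `|G n w| <= `|u 0| + (T * 2 ^ n)%:R * (2 * Mu).
  by apply: le_trans (ler_normD _ _) _; apply: lerD => //; exact: S_le.
exists (\int[P]_w G n w); split; first exact: (bounded_has_mean P (mG n) G_le).
rewrite [X in `|X - _|](_ : _ = u 0 + \int[P]_w S (T * 2 ^ n)%N w); last first.
  rewrite /G RintegralD//; last 2 first.
  - exact: finite_measure_integrable_cst.
  - exact: (bounded_integrable _ (mS _) (S_le _)).
  rewrite (Rintegral_cst P measurableT) (_ : fine (P setT) = 1) ?mulr1//.
  by rewrite probability_setT.
rewrite addrAC subrr add0r; apply: le_trans (ES _) _.
rewrite natrM (_ : _ * _ = T%:R * C * Num.sqrt h)//.
by rewrite /h; field; rewrite pnatr_eq0 expn_eq0.
Qed.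

(** With [u'' = 2 V u] below the level [c], the process
    [exp(- int_0^t V(B)) u(B_t)] stopped at [c] is a martingale. *)
Lemma feynman_kac (rho : Omega -> R) :
  {ae P, forall w, stopped_at c T%:R (B ^~ w) (rho w)} ->
  has_mean P (fun w => expR (- \int[mu]_(t in `[0, rho w]) V (B t w)) * u (B (rho w) w)) (u 0).
Proof.
move=> hrho; have /choice[m hm] := mean_G.
have Gae : {ae P, forall w, (forall n, `|G n w| <= Mu) /\
    G n w @[n --> \oo] --> expR (- \int[mu]_(t in `[0, rho w]) V (B t w)) * u (B (rho w) w)}.
  apply: filterS3 hrho (bm_start hB) (bm_cont hB) => w [/andP[r0 rT] below reach] b0 cw.
  pose be t := B (Num.max t 0) w.
  have cb : continuous be by exact: (continuous_positive_part cw).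
  have beE t : 0 <= t -> be t = B t w by rewrite /be => /max_idPl ->.
  have beb t : 0 <= t -> b t w = be t by move=> t0; rewrite /b b0 subr0 beE.
  have ME n k : M n k w = killed u (V \o be) be n k.
    rewrite /M /killed beb ?dyadic_ge0//; congr (expR (- _) * _).
    by apply: eq_bigr => j _; rewrite /= beb// dyadic_ge0.
  have belowE n k : \1_(before_level n k) w = `[< dyadic_below be c n k >]%:R :> R.
    rewrite indicE; congr (_%:R); congr nat_of_bool.
    apply/idP/asboolP; rewrite inE => -[p H]; exists p => l j jk.
      by rewrite -beb ?dyadic_ge0//; exact: H.
    by rewrite beb ?dyadic_ge0//; exact: H.
  have st : stopped_at c T%:R be (rho w).
    split; first by rewrite r0.
    - by move=> t t0 tr; rewrite beE//; exact: below.
    - by rewrite beE.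
  have cVb : continuous (V \o be) by move=> t; apply: continuous_comp; [exact: cb|exact: cV].
  have VMb t : `|(V \o be) t| <= MV by rewrite /= ger0_norm.
  have [eqk cv] := killed_stopped_cvg cu cVb cb VMb st.
  have GE n : G n w = killed u (V \o be) be n 0 +
      \sum_(k < T * 2 ^ n) `[< dyadic_below be c n k >]%:R *
      (killed u (V \o be) be n k.+1 - killed u (V \o be) be n k).
    rewrite /G; congr (_ + _).
      by rewrite /killed big_ord0 oppr0 expR0 mul1r /dyadic mul0r beE// b0.
    by apply: eq_bigr => k _; rewrite belowE !ME.
  split.
    by move=> n; rewrite GE; have [k ->] := eqk n; exact: killed_le.
  under eq_fun do rewrite GE.
  rewrite -(beE (rho w))// (_ : \int[mu]_(t in _) _ = \int[mu]_(t in `[0, rho w]) (V \o be) t)//.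
  apply: eq_Rintegral => t; rewrite inE/= in_itv/= => /andP[t0 _].
  by rewrite beE.
apply: (@has_mean_cvg _ _ _ P G _ Mu m).
- by move=> n; have [] := hm n.
- by apply: filterS Gae => w [].
- by apply: filterS Gae => w [].
- apply/cvgrPdist_le => e e0.
  have : T%:R * C * Num.sqrt (2 ^ n)%:R^-1 @[n --> \oo] --> 0.
    rewrite -(mulr0 (T%:R * C)); apply: cvgM; first exact: cvg_cst.
    rewrite -sqrtr0; apply: (cvg_comp _ _ cvg_mesh); exact: sqrt_continuous.
  move=> /cvgr_le /(_ _ e0); apply: filterS => n; apply: le_trans.
  by rewrite distrC; have [] := hm n.
Qed.
End horizon.

End feynman_kac.

(** * Hitting times *)

Section first_hits.
Context {R : realType}.
Notation mu := (@lebesgue_measure R).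
Implicit Types (beta : R -> R) (c T rho sigma : R).

Definition first_hit c beta sigma : Prop :=
  [/\ 0 <= sigma, beta sigma = c & forall t, 0 <= t -> t < sigma -> beta t < c].

Lemma first_hit_exists c beta t : continuous beta -> beta 0 < c -> 0 <= t ->
  c <= beta t -> exists2 sigma, sigma <= t & first_hit c beta sigma.
Proof.
move=> cb b0 t0 ct.
pose A := [set s | 0 <= s /\ beta s = c].
have hit s : 0 <= s -> c <= beta s -> exists2 r, 0 <= r <= s & A r.
  move=> s0 cs; have [||r] := @IVT _ beta 0 s c s0.
  - exact: continuous_subspaceT.
  - by rewrite ge_min le_max (ltW b0) cs orbT.
  - by rewrite in_itv/= => /andP[r0 rs] br; exists r; rewrite ?r0 ?rs.
have [r /andP[r0 rt] Ar] := hit t t0 ct.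
have hA : has_inf A by split; [exists r|exists 0 => s []].
have iA s : A s -> inf A <= s by move=> As; apply: ge_inf => //; exact: hA.2.
have i0 : 0 <= inf A by apply: lb_le_inf; [exists r|move=> s []].
have bi : beta (inf A) = c.
  apply/eqP; apply/negPn/negP => bc.
  have e0 : 0 < `|beta (inf A) - c| by rewrite normr_gt0 subr_eq0.
  have /nbhs_ballP[d /= d0 hd] : \forall s \near inf A, `|beta (inf A) - beta s| < `|beta (inf A) - c|.
    by have /cvgrPdist_lt := cb (inf A); exact.
  have [s As sd] := inf_adherent d0 hA.
  have := hd s; rewrite /ball/= distrC ger0_norm ?subr_ge0 ?iA// ltrBlDl => /(_ sd).
  by rewrite As.2 ltxx.
exists (inf A); first exact: le_trans (iA _ Ar) rt.
split => // s s0 si; rewrite ltNge; apply/negP => cs.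
have [q /andP[_ qs] Aq] := hit s s0 cs.
by have := lt_le_trans si (le_trans (iA _ Aq) qs); rewrite ltxx.
Qed.

Lemma stopped_at_exists c T beta : continuous beta -> beta 0 < c -> 0 <= T ->
  exists2 rho, stopped_at c T beta rho & beta rho <= c.
Proof.
move=> cb b0 T0.
have [[t /andP[t0 tT] ct]|H] := pselect (exists2 t, 0 <= t <= T & c <= beta t).
  have [s st [s0 sc below]] := first_hit_exists cb b0 t0 ct.
  exists s; last by rewrite sc.
  split => //; last by right; rewrite sc.
  by rewrite s0 (le_trans st).
have H' t : 0 <= t -> t <= T -> beta t < c.
  move=> t0 tT; rewrite ltNge; apply/negP => ct; apply: H.
  by exists t => //; rewrite t0.
exists T; last by rewrite ltW// H'.
split; [by rewrite lexx T0|move=> t t0 /ltW; exact: H'|by left].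
Qed.

Lemma stopped_at_hit c T beta rho sigma : first_hit c beta sigma -> sigma <= T ->
  stopped_at c T beta rho -> rho = sigma.
Proof.
move=> [s0 bs below] sT [/andP[r0 rT] rbelow rend].
have [rs|sr|//] := ltgtP rho sigma.
- case: rend => [rE|]; first by move: rs; rewrite rE ltNge sT.
  by rewrite leNgt below.
- by have := rbelow _ s0 sr; rewrite bs ltxx.
Qed.

Lemma stopped_at_nohit c T beta rho : (forall t, 0 <= t -> beta t < c) ->
  stopped_at c T beta rho -> rho = T.
Proof.
by move=> H [/andP[r0 _] _ [//|]]; rewrite leNgt H.
Qed.

End first_hits.

Section taylor_tools.
Context {R : realType}.
Implicit Types (f u : R -> R).

(** By the mean value theorem, integration raises the order of vanishing by
    one. *)
Lemma increment_bound (f f' : R -> R) (k A : R) (n : nat) : f 0 = 0 -> 0 <= k ->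
  (forall x : R, is_derive x (1 : R) f (f' x)) ->
  (forall x, `|x| <= A -> `|f' x| <= k * `|x| ^+ n) ->
  forall x, `|x| <= A -> `|f x| <= k * `|x| ^+ n.+1.
Proof.
move=> f0 k0 df hf' x xA.
have cf : continuous f.
  move=> y; apply: differentiable_continuous.
  by apply/derivable1_diffP; have [] := df y.
have bound z : `|z| <= `|x| -> `|f' z * x| <= k * `|x| ^+ n.+1.
  move=> zx; rewrite normrM exprSr mulrA; apply: ler_pM => //.
  apply: (le_trans (hf' z (le_trans zx xA))); apply: ler_wpM2l => //.
  by rewrite lerXn2r ?nnegrE.
have [x0|x0] := leP 0 x.
- have [z] := MVT_segment x0 (fun z _ => df z) (continuous_subspaceT cf).
  rewrite in_itv/= f0 !subr0 => /andP[z0 zx] ->; apply: bound.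
  by rewrite !ger0_norm.
- have [z] := MVT_segment (ltW x0) (fun z _ => df z) (continuous_subspaceT cf).
  rewrite in_itv/= f0 !sub0r => /andP[xz z0] fE.
  rewrite -normrN fE mulrN normrN; apply: bound.
  by rewrite !ler0_norm ?(ltW x0)// lerN2.
Qed.

Lemma expR_taylor3 (A x : R) : `|x| <= A ->
  `|expR x - 1 - x - x ^+ 2 / 2| <= expR A * `|x| ^+ 3.
Proof.
have e0 : 0 <= expR A by exact: expR_ge0.
have s1 : forall y, `|y| <= A -> `|expR y - 1| <= expR A * `|y| ^+ 1.
  have d1 (z : R) : is_derive z (1 : R) (fun y => expR y - 1) (expR z).
    by apply: is_derive_eq; rewrite subr0.
  apply: (increment_bound (n := 0%N) _ e0 d1) => //.
  - by rewrite expR0 subrr.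
  - move=> z zA; rewrite expr0 mulr1 ger0_norm ?expR_ge0// ler_expR.
    by apply: le_trans zA; exact: ler_norm.
have s2 : forall y, `|y| <= A -> `|expR y - 1 - y| <= expR A * `|y| ^+ 2.
  have d2 (z : R) : is_derive z (1 : R) (fun y => expR y - 1 - y) (expR z - 1).
    by apply: is_derive_eq; rewrite subr0.
  apply: (increment_bound (n := 1%N) _ e0 d2) => //.
  by rewrite expR0 subrr subr0.
have d3 (z : R) : is_derive z (1 : R) (fun y => expR y - 1 - y - y ^+ 2 / 2) (expR z - 1 - z).
  by apply: is_derive_eq; rewrite /GRing.scale/=; field.
move: x; apply: (increment_bound (n := 2%N) _ e0 d3) => //.
by rewrite expR0 subrr expr0n/= mul0r !subr0.
Qed.

(** Flattening a function beyond [c + 1] makes it bounded without affecting its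
    second-order expansions at points below [c]. *)
Lemma taylor_truncation (c K U U1 U2 : R) (v v1 v2 : R -> R) :
  0 <= K -> (forall x, x <= c + 1 -> `|v x| <= U) ->
  (forall x, x < c -> `|v1 x| <= U1) -> (forall x, x < c -> `|v2 x| <= U2) ->
  (forall x z, x < c -> `|z| <= 1 ->
     `|v (x + z) - v x - v1 x * z - v2 x * z ^+ 2| <= K * `|z| ^+ 3) ->
  forall x z, x < c ->
    `|v (Num.min (x + z) (c + 1)) - v (Num.min x (c + 1)) - v1 x * z - v2 x * z ^+ 2|
    <= (K + 2 * U + U1 + U2) * `|z| ^+ 3.
Proof.
move=> K0 hU hU1 hU2 hK x z xc.
have xc1 : x <= c + 1 by apply: (le_trans (ltW xc)); rewrite lerDl.
have U_0 : 0 <= U by apply: le_trans (hU _ xc1); exact: normr_ge0.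
have U1_0 : 0 <= U1 by apply: le_trans (hU1 _ xc); exact: normr_ge0.
have U2_0 : 0 <= U2 by apply: le_trans (hU2 _ xc); exact: normr_ge0.
rewrite (min_idPl xc1).
have [z1|z1] := leP `|z| 1.
  have xz : x + z <= c + 1.
    by apply: lerD; [exact: ltW|exact: le_trans (ler_norm _) z1].
  rewrite (min_idPl xz); apply: le_trans (hK _ _ xc z1) _.
  rewrite ler_wpM2r ?exprn_ge0//; lra.
have le13 : 1 <= `|z| ^+ 3 by rewrite exprn_ege1// ltW.
have lez : `|z| <= `|z| ^+ 3 by rewrite -{1}[`|z|]expr1 ler_eXn2l.
have lez2 : `|z| ^+ 2 <= `|z| ^+ 3 by rewrite ler_eXn2l.
have hm := hU (Num.min (x + z) (c + 1)); rewrite ge_min lexx orbT in hm.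
have {}hm := hm isT.
apply: le_trans (ler_normB _ _) _.
rewrite !mulrDl; apply: lerD; last first.
  by rewrite normrM normrX; apply: ler_pM => //; exact: hU2.
apply: le_trans (ler_normB _ _) _; apply: lerD; last first.
  by rewrite normrM; apply: ler_pM => //; exact: hU1.
apply: le_trans (ler_normB _ _) _.
apply: (@le_trans _ _ (2 * U * `|z| ^+ 3)); last first.
  have : 0 <= K * `|z| ^+ 3 by rewrite mulr_ge0// exprn_ge0.
  lra.
apply: (@le_trans _ _ (2 * U)).
  by have := hU _ xc1; lra.
by rewrite ler_peMr// mulr_ge0.
Qed.

End taylor_tools.

Section recurrence.
Context {R : realType} {d : measure_display} {Omega : measurableType d}.
Variable P : probability Omega R.
Variable B : R -> {RV P >-> R}.
Hypothesis hB : standard_brownian_motion B.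
Notation mu := (@lebesgue_measure R).

Lemma good_paths : {ae P, forall w, exists2 be : R -> R, continuous be /\ be 0 = 0 &
  forall t, 0 <= t -> be t = B t w}.
Proof.
apply: filterS2 (bm_start hB) (bm_cont hB) => w b0 cw.
exists (fun t => B (Num.max t 0) w); last by move=> t /max_idPl ->.
by split; [exact: (continuous_positive_part cw)|rewrite maxxx].
Qed.

Variable c : R.
Hypothesis c0 : 0 < c.

Lemma stopped_at_choice (T : R) : 0 <= T -> exists rho : Omega -> R,
  {ae P, forall w, stopped_at c T (B ^~ w) (rho w) /\ B (rho w) w <= c}.
Proof.
move=> T0; pose Q w r := stopped_at c T (B ^~ w) r /\ B r w <= c.
exists (fun w => xget 0 [set r | Q w r]).
apply: filterS good_paths => w [be [cb b0] beE].
have [rho [/andP[r0 rT] below rend] rc] : exists2 rho, stopped_at c T be rho & be rho <= c.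
  by apply: stopped_at_exists => //; rewrite b0.
apply: (@xgetPex _ 0 [set r | Q w r]); exists rho; split; last by rewrite -beE.
split; first by rewrite r0.
- by move=> t t0 tr; rewrite -beE//; exact: below.
- by rewrite -beE.
Qed.

(** By [feynman_kac] with [u(x) = exp(th x)] and constant [V = th^2 / 2], the
    variable [exp(- th^2 sigma / 2)], read as [0] when the level is never
    reached, has mean [exp(- th c)]. Now let [th] tend to [0]. *)
Lemma hits_level : {ae P, forall w, exists sigma, first_hit c (B ^~ w) sigma}.
Proof.
have /choice[rho hrho] : forall T : nat, exists rho : Omega -> R,
    {ae P, forall w, stopped_at c T%:R (B ^~ w) (rho w) /\ B (rho w) w <= c}.
  by move=> T; apply: stopped_at_choice.
have {}hrho : {ae P, forall w, forall T, stopped_at c T%:R (B ^~ w) (rho T w) /\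
    B (rho T w) w <= c} by exact: ae_foralln.
(* the value -1 marks the paths that never reach [c] *)
pose sigma w := xget (-1) [set s | first_hit c (B ^~ w) s].
pose Y (th : R) w := if sigma w < 0 then 0 else expR (- (th ^+ 2 / 2 * sigma w)).
have sigmaP : {ae P, forall w, (0 <= sigma w /\ first_hit c (B ^~ w) (sigma w)) \/
    (sigma w < 0 /\ forall t, 0 <= t -> B t w < c)}.
  apply: filterS good_paths => w [be [cb b0] beE].
  have [[s hs]|H] := pselect (exists s, first_hit c (B ^~ w) s).
    have hit : first_hit c (B ^~ w) (sigma w).
      by apply: (@xgetPex _ (-1) [set s | first_hit c (B ^~ w) s]); exists s.
    by left; split => //; have [] := hit.
  right; split.
    rewrite /sigma xgetPN ?ltrN10// => s hs; apply: H; by exists s.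
  move=> t t0; rewrite ltNge; apply/negP => ct; apply: H.
  have [||s _ [s0 sc below]] := @first_hit_exists _ c be t cb _ t0.
  - by rewrite b0.
  - by rewrite beE.
  exists s; split => //; first by rewrite -beE.
  by move=> r r0 rs; rewrite -beE//; exact: below.
have meanY (th : R) : 0 < th -> has_mean P (Y th) (expR (- (th * c))).
  move=> th0.
  (* [feynman_kac] asks for a bounded function, and only the values below [c]
     matter *)
  pose v x : R := expR (th * x).
  pose u x := v (Num.min x (c + 1)).
  pose X T w := expR (- \int[mu]_(t in `[0, rho T w]) (th ^+ 2 / 2)) * u (B (rho T w) w).
  have v_le x : x <= c + 1 -> `|v x| <= v (c + 1).
    by move=> xc; rewrite ger0_norm ?expR_ge0// ler_expR ler_pM2l.
  have vc1 x : x < c -> `|v x| <= v (c + 1).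
    by move=> xc; apply: v_le; apply: (le_trans (ltW xc)); rewrite lerDl.
  have th2 : 0 <= th ^+ 2 / 2 by rewrite divr_ge0// sqr_ge0.
  have meanX T : has_mean P (X T) 1.
    have u0 : u 0 = 1 by rewrite /u (min_idPl _) ?addr_ge0 ?(ltW c0)// /v mulr0 expR0.
    rewrite -u0; apply: (@feynman_kac _ _ _ P B hB c
      (v (c + 1) * (expR th * th ^+ 3) + 2 * v (c + 1) + th * v (c + 1) + th ^+ 2 / 2 * v (c + 1))
      (v (c + 1)) (th ^+ 2 / 2) u (fun x => th * v x) (fun=> th ^+ 2 / 2)
      _ _ _ _ _ _ T (rho T)).
    - move=> x; apply: (@continuous_comp _ _ _ (fun x => Num.min x (c + 1)) v).
        by apply: continuous_min; [exact: cvg_id|exact: cvg_cst].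
      apply: continuous_comp; last exact: continuous_expR.
      by apply: cvgM; [exact: cvg_cst|exact: cvg_id].
    - by move=> x; exact: cvg_cst.
    - by move=> x; rewrite /u v_le// ge_min lexx orbT.
    - by [].
    - by [].
    - move=> x z xc.
      have := @taylor_truncation R c (v (c + 1) * (expR th * th ^+ 3)) (v (c + 1))
        (th * v (c + 1)) (th ^+ 2 / 2 * v (c + 1)) v (fun x => th * v x)
        (fun x => th ^+ 2 / 2 * v x) _ v_le _ _ _ x z xc.
      have xc1 : x <= c + 1 by apply: (le_trans (ltW xc)); rewrite lerDl.
      rewrite /u (min_idPl xc1); apply.
      + by rewrite mulr_ge0 ?expR_ge0// mulr_ge0 ?expR_ge0// exprn_ge0// ltW.
      + by move=> y yc; rewrite normrM gtr0_norm// ler_pM2l// vc1.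
      + by move=> y yc; rewrite normrM ger0_norm// ler_wpM2l// vc1.
      + move=> y r yc r1.
        rewrite (_ : _ - _ - _ - _ = v y * (expR (th * r) - 1 - th * r - (th * r) ^+ 2 / 2)); last first.
          by rewrite /v mulrDr expRD; field.
        rewrite normrM -[leRHS]mulrA; apply: ler_pM => //; first exact: vc1.
        have thr : `|th * r| <= th by rewrite normrM gtr0_norm// ler_piMr// ltW.
        by apply: le_trans (expR_taylor3 thr) _; rewrite normrM gtr0_norm// exprMn mulrA.
    - by apply: filterS hrho => w /(_ T)[].
  have XY : {ae P, forall w, (forall T, `|X T w| <= expR (th * c)) /\
      X T w @[T --> \oo] --> expR (th * c) * Y th w}.
    apply: filterS2 hrho sigmaP => w hr hs.
    have XE T : X T w = expR (- (th ^+ 2 / 2 * rho T w)) * expR (th * B (rho T w) w).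
      have [[/andP[r0 rT] _ _] rc] := hr T.
      rewrite /X Rintegral_cst//= lebesgue_measure_itv/= lte_fin /u /v (min_idPl _); last first.
        by apply: (le_trans rc); rewrite lerDl.
      case: ifPn => [_|]; first by rewrite -EFinD subr0.
      by rewrite -leNgt => r0'; rewrite (_ : rho T w = 0) ?mulr0//; apply/le_anti; rewrite r0 r0'.
    split.
      move=> T; rewrite XE ger0_norm ?mulr_ge0 ?expR_ge0//.
      have [[/andP[r0 rT] _ _] rc] := hr T.
      rewrite -[leRHS]mul1r; apply: ler_pM; rewrite ?expR_ge0//.
        by rewrite -[leRHS]expR0 ler_expR oppr_le0 mulr_ge0.
      by rewrite ler_expR ler_pM2l.
    case: hs => [[s0 hit]|[s0 nohit]].
      apply: cvg_near_cst; exists (Num.trunc (sigma w)).+1 => // T /= sT.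
      have [st _] := hr T.
      have sT' : sigma w <= T%:R.
        have /andP[_ /ltW h] := truncn_itv s0.
        by apply: (le_trans h); rewrite ler_nat.
      rewrite XE (stopped_at_hit hit sT' st) /Y ltNge s0/=.
      by have [_ -> _] := hit; rewrite mulrC.
    rewrite /Y s0 mulr0.
    apply: (@squeeze_cvgr _ _ _ _ (fun=> 0) (fun T : nat => expR (- (th ^+ 2 / 2 * T%:R)) * expR (th * c))).
    - apply: nearW => T; rewrite XE mulr_ge0 ?expR_ge0//=.
      have [st rc] := hr T; rewrite (stopped_at_nohit nohit st) in rc *.
      by apply: ler_pM; rewrite ?expR_ge0// ler_expR ler_pM2l.
    - exact: cvg_cst.
    - rewrite -(mul0r (expR (th * c))); apply: cvgM; last exact: cvg_cst.
      apply: (@cvg_comp _ _ _ (fun T : nat => th ^+ 2 / 2 * T%:R) (fun x => expR (- x)) _ _ _ _ (@cvgr_expR R)).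
      have th20 : 0 < th ^+ 2 / 2 by rewrite divr_gt0// exprn_gt0.
      apply/cvgryPge => A; near=> T.
      rewrite -ler_pdivrMl//; near: T; exact: nbhs_infty_ger.
  have meanE : has_mean P (fun w => expR (th * c) * Y th w) 1.
    apply: (@has_mean_cvg _ _ _ P X _ (expR (th * c)) (fun=> 1)) => //.
    - by apply: filterS XY => w [].
    - by apply: filterS XY => w [].
    - exact: cvg_cst.
  have := has_mean_scale (expR (- (th * c))) meanE; rewrite mulr1.
  apply: has_mean_ae; apply: aeW => w.
  by rewrite mulrA -expRD addNr expR0 mul1r.
have : has_mean P (fun w => if sigma w < 0 then 0 else 1) 1.
  apply: (@has_mean_cvg _ _ _ P (fun n => Y n.+1%:R^-1) _ 1
    (fun n => expR (- (n.+1%:R^-1 * c)))).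
  - by move=> n; apply: meanY; rewrite invr_gt0 ltr0n.
  - apply: aeW => w n; rewrite /Y; case: ltP => s0; first by rewrite normr0.
    rewrite ger0_norm ?expR_ge0// -[leRHS]expR0 ler_expR oppr_le0.
    by rewrite mulr_ge0// divr_ge0// sqr_ge0.
  - apply: aeW => w; rewrite /Y; case: ltP => s0; first exact: cvg_cst.
    rewrite -[X in _ --> X]expR0; apply: (@cvg_comp _ _ _ (fun n => - (n.+1%:R^-1 ^+ 2 / 2 * sigma w)) expR _ _ _ _ (@continuous_expR R _)).
    rewrite -oppr0; apply: cvgN; rewrite -(mul0r (sigma w)); apply: cvgM; last exact: cvg_cst.
    rewrite -(mul0r 2^-1); apply: cvgM; last exact: cvg_cst.
    rewrite -(mul0r (0:R)); apply: cvgM; exact: cvg_harmonic.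
  - rewrite -[X in _ --> X]expR0; apply: (@cvg_comp _ _ _ (fun n => - (n.+1%:R^-1 * c)) expR _ _ _ _ (@continuous_expR R _)).
    rewrite -oppr0; apply: cvgN; rewrite -(mul0r c); apply: cvgM; last exact: cvg_cst.
    exact: cvg_harmonic.
move=> [Z [mZ ZE EZ]].
have Z1 : {ae P, forall w, Z w = 1}.
  have mZ' : measurable_fun setT (EFin \o Z) by exact/measurable_EFinP.
  have iZ : P.-integrable setT (EFin \o Z).
    by apply/integrableP; split => //; rewrite integral_fin_num_abs// EZ.
  have mZ1 : measurable_fun setT (fun w => (1 - Z w)%:E).
    by apply/measurable_EFinP; exact: measurable_funB.
  have : (\int[P]_w `|(1 - Z w)%:E| = 0)%E.
    transitivity (\int[P]_w (1 - Z w)%:E)%E; last first.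
      under eq_integral do rewrite EFinB.
      rewrite integralB//; last exact: finite_measure_integrable_cst.
      rewrite EZ (_ : (\int[P]__ 1)%E = (1 * P setT)%E); last exact: integral_cst.
      by rewrite probability_setT mule1 subee.
    apply: ae_eq_integral => //; first exact: measurableT_comp.
    apply: filterS ZE => w <- _ /=; case: ifP => _; first by rewrite subr0 normr1.
    by rewrite subrr normr0.
  move=> /(ae_eq_integral_abs P measurableT mZ1); apply: filterS => w /(_ I) /= [].
  by move/eqP; rewrite subr_eq0 => /eqP.
apply: filterS3 sigmaP ZE Z1 => w [[s0 hit] _ _|[s0 _] zE z1].
  by exists (sigma w).
by move: zE; rewrite s0 z1 => /eqP; rewrite eq_sym oner_eq0.
Unshelve. all: end_near. Qed.

End recurrence.

(** * Tent potentials *)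

Section tent.
Context {R : realType}.
Implicit Types (y e lam x z : R).

Definition pos x : R := Num.max x 0.

Lemma continuous_pos : continuous pos.
Proof. by move=> x; apply: continuous_max; [exact: cvg_id|exact: cvg_cst]. Qed.

Lemma pos_cube_taylor x z :
  `|pos (x + z) ^+ 3 - pos x ^+ 3 - 3 * pos x ^+ 2 * z - 3 * pos x * z ^+ 2| <= `|z| ^+ 3.
Proof.
rewrite /pos -normrX; case: (leP x 0) => x0; case: (leP (x + z) 0) => xz0.
- by rewrite (_ : _ - _ - _ - _ = 0) ?normr0//; ring.
- rewrite (_ : _ - _ - _ - _ = (x + z) ^+ 3); last by ring.
  have z0 : 0 <= z by lra.
  rewrite !ger0_norm ?exprn_ge0 ?(ltW xz0)// lerXn2r ?nnegrE ?(ltW xz0)//; lra.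
- rewrite expr0n/= sub0r.
  have z0 : z <= 0 by lra.
  rewrite (_ : _ - _ - _ = z ^+ 3 - (x + z) ^+ 3); last by ring.
  have h1 : (x + z) ^+ 3 <= 0 by rewrite exprS mulr_le0_ge0// sqr_ge0.
  have h2 : z ^+ 3 <= (x + z) ^+ 3.
    have := sqr_ge0 (x + 2 * z); have := sqr_ge0 x; nra.
  rewrite !ler0_norm; lra.
- by rewrite (_ : _ - _ - _ - _ = z ^+ 3)//; ring.
Qed.

(** The tent of unit mass on the interval from [y] to [y + 2 e], and the
    function with this second derivative that vanishes to the left of [y]. *)
Definition tent y e x : R :=
  (pos (x - y) - 2 * pos (x - y - e) + pos (x - y - 2 * e)) / e ^+ 2.
Definition tent_potential y e x : R :=
  (pos (x - y) ^+ 3 - 2 * pos (x - y - e) ^+ 3 + pos (x - y - 2 * e) ^+ 3) / (6 * e ^+ 2).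
Definition tent_slope y e x : R :=
  (pos (x - y) ^+ 2 - 2 * pos (x - y - e) ^+ 2 + pos (x - y - 2 * e) ^+ 2) / (2 * e ^+ 2).

Variables (y e : R).
Hypothesis e0 : 0 < e.

Let e20 : 0 < e ^+ 2. Proof. exact: exprn_gt0. Qed.

Let cvg_pos k x : pos (x' - k) @[x' --> x] --> pos (x - k).
Proof.
apply: (@cvg_comp _ _ _ (fun x' => x' - k) pos _ _ _ _ (@continuous_pos _)).
by apply: cvgB; [exact: cvg_id|exact: cvg_cst].
Qed.

Lemma continuous_tent : continuous (tent y e).
Proof.
rewrite (_ : tent y e = fun x =>
  (pos (x - y) - 2 * pos (x - (y + e)) + pos (x - (y + 2 * e))) / e ^+ 2); last first.
  by apply/funext => x; rewrite /tent !opprD !addrA.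
move=> x; apply: cvgM; last exact: cvg_cst.
apply: cvgD; last exact: cvg_pos.
apply: cvgB; first exact: cvg_pos.
by apply: cvgM; [exact: cvg_cst|exact: cvg_pos].
Qed.

Lemma continuous_tent_potential : continuous (tent_potential y e).
Proof.
rewrite (_ : tent_potential y e = fun x => (pos (x - y) ^+ 3
  - 2 * pos (x - (y + e)) ^+ 3 + pos (x - (y + 2 * e)) ^+ 3) / (6 * e ^+ 2)); last first.
  by apply/funext => x; rewrite /tent_potential !opprD !addrA.
have h k x : pos (x' - k) ^+ 3 @[x' --> x] --> pos (x - k) ^+ 3.
  exact: (@cvg_comp _ _ _ (fun x' => pos (x' - k)) (fun z => z ^+ 3) _ _ _
    (@cvg_pos _ _) (@exprn_continuous _ 3 _)).
move=> x; apply: cvgM; last exact: cvg_cst.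
apply: cvgD; last exact: h.
apply: cvgB; first exact: h.
by apply: cvgM; [exact: cvg_cst|exact: h].
Qed.

Lemma tent_ge0 x : 0 <= tent y e x.
Proof.
have ep := e0.
rewrite /tent divr_ge0 ?(ltW e20)// /pos.
case: (leP (x - y) 0); case: (leP (x - y - e) 0); case: (leP (x - y - 2 * e) 0); lra.
Qed.

Lemma tent_le x : tent y e x <= e^-1.
Proof.
have ep := e0.
rewrite /tent ler_pdivrMr// expr2 mulrA mulVf ?gt_eqF// mul1r /pos.
case: (leP (x - y) 0); case: (leP (x - y - e) 0); case: (leP (x - y - 2 * e) 0); lra.
Qed.

Lemma tent_out x : x <= y \/ y + 2 * e <= x -> tent y e x = 0.
Proof.
have ep := e0; move=> H; rewrite /tent (_ : _ - _ + _ = 0) ?mul0r// /pos.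
move: H; case: (leP (x - y) 0); case: (leP (x - y - e) 0); case: (leP (x - y - 2 * e) 0);
  move=> ? ? ? []; lra.
Qed.

Lemma tent_potential_ge0 x : 0 <= tent_potential y e x.
Proof.
have ep := e0.
have den : 0 <= 6 * e ^+ 2 by exact: (mulr_ge0 (ler0n _ _) (ltW e20)).
rewrite /tent_potential divr_ge0// /pos.
set z := x - y.
case: (leP z 0) => h1; case: (leP (z - e) 0) => h2; case: (leP (z - 2 * e) 0) => h3;
  rewrite ?expr0n/= ?mulr0 ?addr0 ?subr0//; try lra.
- by rewrite exprn_ge0// ltW.
- have : 0 <= (z - e) ^+ 2 * (2 * e - z).
    by rewrite mulr_ge0 ?sqr_ge0//; lra.
  have e2 : 0 <= e ^+ 2 by rewrite ltW.
  have : 0 <= e * (z - e) * (2 * e - z) by rewrite !mulr_ge0//; lra.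
  have : 0 <= e ^+ 2 * (z - e) by rewrite mulr_ge0//; lra.
  have : 0 <= e ^+ 2 * e by rewrite mulr_ge0// ltW.
  nra.
- rewrite (_ : _ + _ = 6 * (e ^+ 2 * (z - e))); last by ring.
  by rewrite mulr_ge0// mulr_ge0// ltW// ltW.
Qed.

Lemma tent_potential_left x : x <= y -> tent_potential y e x = 0.
Proof.
have ep := e0; move=> xy; rewrite /tent_potential /pos.
have [h1 h2 h3] : [/\ x - y <= 0, x - y - e <= 0 & x - y - 2 * e <= 0] by split; lra.
rewrite (max_idPr h1) (max_idPr h2) (max_idPr h3) expr0n/=.
by rewrite mulr0 subrr add0r mul0r.
Qed.

Lemma tent_potential_right x : y + 2 * e <= x -> tent_potential y e x = x - y - e.
Proof.
have ep := e0; move=> xy; rewrite /tent_potential /pos.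
have [h1 h2 h3] : [/\ 0 <= x - y, 0 <= x - y - e & 0 <= x - y - 2 * e] by split; lra.
rewrite (max_idPl h1) (max_idPl h2) (max_idPl h3).
by field; rewrite gt_eqF.
Qed.

Lemma tent_potential_taylor x z :
  `|tent_potential y e (x + z) - tent_potential y e x - tent_slope y e x * z
    - tent y e x / 2 * z ^+ 2| <= e ^- 2 * `|z| ^+ 3.
Proof.
pose D k := pos (x - y - k + z) ^+ 3 - pos (x - y - k) ^+ 3
  - 3 * pos (x - y - k) ^+ 2 * z - 3 * pos (x - y - k) * z ^+ 2.
rewrite (_ : _ - _ - _ - _ = (6 * e ^+ 2)^-1 * (D 0 - 2 * D e + D (2 * e))); last first.
  rewrite /D /tent_potential /tent_slope /tent !subr0.
  rewrite (_ : x + z - y = x - y + z); last by ring.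
  rewrite (_ : x - y + z - e = x - y - e + z); last by ring.
  rewrite (_ : x - y + z - 2 * e = x - y - 2 * e + z); last by ring.
  by field; rewrite gt_eqF.
have hD k : `|D k| <= `|z| ^+ 3 by exact: pos_cube_taylor.
have den : 0 <= 6 * e ^+ 2 by exact: (mulr_ge0 (ler0n _ _) (ltW e20)).
rewrite normrM [`|(6 * e ^+ 2)^-1|]ger0_norm ?invr_ge0//.
rewrite invfM -mulrA mulrCA; apply: ler_wpM2l; first by rewrite invr_ge0 ltW.
rewrite ler_pdivrMl//.
apply: le_trans (ler_normD _ _) _.
have := hD 0; have := hD e; have := hD (2 * e).
have := normr_ge0 (D 0); have := ler_normB (D 0) (2 * D e).
rewrite [`|2 * _|]normrM [`|2|]ger0_norm//.
lra.
Qed.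

Lemma tent_potential_bounds (m : R) : exists U, forall x, x <= m ->
  tent_potential y e x <= U /\ `|tent_slope y e x| <= U.
Proof.
pose k := pos (m - y).
have k0 : 0 <= k by rewrite le_max lexx orbT.
have ep := e0; exists (k ^+ 3 / e ^+ 2 + 2 * k ^+ 2 / e ^+ 2) => x xm.
have hp j : 0 <= j -> 0 <= pos (x - y - j) <= k.
  move=> j0; rewrite le_max lexx orbT/= /k /pos ge_max !le_max lexx orbT andbT.
  by apply/orP; left; lra.
have /andP[a0 ak] := hp 0 (lexx _); rewrite subr0 in a0 ak.
have /andP[b0 bk] := hp e (ltW e0).
have /andP[c0 ck] : 0 <= pos (x - y - 2 * e) <= k by apply: hp; lra.
have cube r : 0 <= r -> r <= k -> 0 <= r ^+ 3 <= k ^+ 3.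
  by move=> r0 rk; rewrite exprn_ge0//= lerXn2r.
have sq r : 0 <= r -> r <= k -> 0 <= r ^+ 2 <= k ^+ 2.
  by move=> r0 rk; rewrite exprn_ge0//= lerXn2r.
have /andP[? ?] := cube _ a0 ak; have /andP[? ?] := cube _ b0 bk.
have /andP[? ?] := cube _ c0 ck; have /andP[? ?] := sq _ a0 ak.
have /andP[? ?] := sq _ b0 bk; have /andP[? ?] := sq _ c0 ck.
have k3 : 0 <= k ^+ 3 / e ^+ 2 by rewrite divr_ge0 ?exprn_ge0// ltW.
have k2 : 0 <= 2 * k ^+ 2 / e ^+ 2 by rewrite divr_ge0 ?mulr_ge0 ?exprn_ge0// ltW.
split.
  apply: (@le_trans _ _ (k ^+ 3 / e ^+ 2)); last by rewrite lerDl.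
  rewrite /tent_potential invfM mulrA ler_pM2r ?invr_gt0//; lra.
apply: (@le_trans _ _ (2 * k ^+ 2 / e ^+ 2)); last by rewrite lerDr.
rewrite /tent_slope invfM mulrA normrM [`|e ^- 2|]gtr0_norm ?invr_gt0//.
rewrite ler_pM2r ?invr_gt0// ler_norml; apply/andP; split; lra.
Qed.

End tent.

Section occupation_laplace.
Context {R : realType} {d : measure_display} {Omega : measurableType d}.
Variable P : probability Omega R.
Variable B : R -> {RV P >-> R}.
Hypothesis hB : standard_brownian_motion B.
Notation mu := (@lebesgue_measure R).
Variables (y c lam : R).
Hypotheses (y0 : 0 < y) (lam0 : 0 < lam).

(** The rate [V] for which [u = 1 + 2 lam (tent_potential y e)] solves
    [u'' = 2 V u]. *)
Definition tent_rate e x : R := lam * tent y e x / (1 + 2 * lam * tent_potential y e x).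

Let den1 e x : 0 < e -> 1 <= 1 + 2 * lam * tent_potential y e x.
Proof.
move=> e0; rewrite lerDl; apply: mulr_ge0; last exact: tent_potential_ge0.
exact: (mulr_ge0 (ler0n _ _) (ltW lam0)).
Qed.

Lemma tent_rate_ge0 e x : 0 < e -> 0 <= tent_rate e x.
Proof.
move=> e0; apply: divr_ge0; last exact: le_trans (den1 x e0).
exact: (mulr_ge0 (ltW lam0) (tent_ge0 _ e0 _)).
Qed.

Lemma continuous_tent_rate e : 0 < e -> continuous (tent_rate e).
Proof.
move=> e0 x; apply: cvgM.
  by apply: cvgM; [exact: cvg_cst|exact: continuous_tent].
apply: cvgV; first by rewrite gt_eqF// (lt_le_trans _ (den1 x e0)).
apply: cvgD; first exact: cvg_cst.
by apply: cvgM; [exact: cvg_cst|exact: continuous_tent_potential].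
Qed.

(** [feynman_kac] for [u = 1 + 2 lam (tent_potential y e)], which equals [1] at
    the origin and [1 + 2 lam (c - y - e)] at [c]. The horizon can be removed
    because [sigma] is finite. *)
Lemma occupation_laplace e (sigma : Omega -> R) : 0 < e -> y + 2 * e <= c ->
  {ae P, forall w, first_hit c (B ^~ w) (sigma w)} ->
  has_mean P (fun w => expR (- \int[mu]_(t in `[0, sigma w]) tent_rate e (B t w)))
    (1 + 2 * lam * (c - y - e))^-1.
Proof.
move=> e0 yc hsigma.
have c0 : 0 < c by have := y0; lra.
have [U hU] := @tent_potential_bounds R y e e0 (c + 1).
have U0 : 0 <= U by apply: le_trans (normr_ge0 _) (hU c _).2; rewrite lerDl.
pose v x := 1 + 2 * lam * tent_potential y e x.
pose u x := v (Num.min x (c + 1)).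
have v1 x : 1 <= v x by exact: den1.
have v0 x : 0 <= v x by exact: le_trans (v1 x).
pose UU := 1 + 2 * lam * U.
have vU x : x <= c + 1 -> `|v x| <= UU.
  move=> xc; rewrite ger0_norm// lerD2l ler_wpM2l//; first by rewrite mulr_ge0// ltW.
  by have [] := hU x xc.
have Vv x : tent_rate e x * v x = lam * tent y e x.
  by rewrite /tent_rate divfK// gt_eqF// (lt_le_trans _ (v1 x)).
have V0 x : 0 <= tent_rate e x by exact: tent_rate_ge0.
have V_le x : tent_rate e x <= lam * e^-1.
  apply: (@le_trans _ _ (lam * tent y e x)); last by rewrite ler_pM2l// tent_le.
  by rewrite -Vv ler_peMr.
have /choice[rho hrho] : forall T : nat, exists rho : Omega -> R,
    {ae P, forall w, stopped_at c T%:R (B ^~ w) (rho w) /\ B (rho w) w <= c}.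
  by move=> T; apply: stopped_at_choice.
have {}hrho : {ae P, forall w, forall T, stopped_at c T%:R (B ^~ w) (rho T w) /\
    B (rho T w) w <= c} by exact: ae_foralln.
pose X T w := expR (- \int[mu]_(t in `[0, rho T w]) tent_rate e (B t w)) * u (B (rho T w) w).
have lam2 : 0 < 2 * lam by rewrite mulr_gt0.
have meanX T : has_mean P (X T) 1.
  have u0 : u 0 = 1.
    rewrite /u (min_idPl _) ?addr_ge0 ?(ltW c0)// /v tent_potential_left ?(ltW y0)//.
    by rewrite mulr0 addr0.
  rewrite -u0; apply: (@feynman_kac _ _ _ P B hB c
    (2 * lam * e ^- 2 + 2 * UU + 2 * lam * U + lam * e^-1) UU (lam * e^-1) u
    (fun x => 2 * lam * tent_slope y e x) (tent_rate e) _ _ _ _ _ _ T (rho T)) => //.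
  - move=> x; apply: (@continuous_comp _ _ _ (fun x => Num.min x (c + 1)) v).
      by apply: continuous_min; [exact: cvg_id|exact: cvg_cst].
    apply: cvgD; first exact: cvg_cst.
    by apply: cvgM; [exact: cvg_cst|exact: continuous_tent_potential].
  - exact: continuous_tent_rate.
  - by move=> x; rewrite /u vU// ge_min lexx orbT.
  - move=> x z xc.
    have xc1 : x <= c + 1 by apply: (le_trans (ltW xc)); rewrite lerDl.
    have := @taylor_truncation R c (2 * lam * e ^- 2) UU (2 * lam * U) (lam * e^-1) v
      (fun x => 2 * lam * tent_slope y e x) (fun x => lam * tent y e x) _ vU _ _ _ x z xc.
    rewrite /u (min_idPl xc1) Vv; apply.
    + by rewrite mulr_ge0 ?invr_ge0 ?exprn_ge0// ltW.
    + move=> x' x'c; rewrite normrM gtr0_norm// ler_pM2l//.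
      have x'c1 : x' <= c + 1 by apply: (le_trans (ltW x'c)); rewrite lerDl.
      by have [] := hU _ x'c1.
    + move=> x' _; rewrite normrM !ger0_norm ?(ltW lam0)//; last exact: tent_ge0.
      by rewrite ler_pM2l//; exact: tent_le.
    + move=> x' z' _ _.
      rewrite (_ : _ - _ - _ - _ = 2 * lam * (tent_potential y e (x' + z')
        - tent_potential y e x' - tent_slope y e x' * z' - tent y e x' / 2 * z' ^+ 2)); last first.
        by rewrite /v; field.
      rewrite normrM (gtr0_norm lam2) -[leRHS]mulrA ler_pM2l//; exact: tent_potential_taylor.
  - by apply: filterS hrho => w /(_ T)[].
have uc : u c = 1 + 2 * lam * (c - y - e).
  by rewrite /u (min_idPl _) ?lerDl// /v tent_potential_right.
have uc0 : 0 < u c by rewrite (lt_le_trans _ (v1 _)).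
have meanE : has_mean P
    (fun w => expR (- \int[mu]_(t in `[0, sigma w]) tent_rate e (B t w)) * u c) 1.
  apply: (@has_mean_cvg _ _ _ P X _ UU (fun=> 1)) => //; last exact: cvg_cst.
  - apply: aeW => w T; rewrite normrM -[leRHS]mul1r; apply: ler_pM => //.
      rewrite ger0_norm ?expR_ge0// -[leRHS]expR0 ler_expR oppr_le0.
      by apply: Rintegral_ge0.
    by rewrite /u vU// ge_min lexx orbT.
  - apply: filterS2 hrho hsigma => w hr hit.
    apply: cvg_near_cst; exists (Num.trunc (sigma w)).+1 => // T /= sT.
    have [s0 _ _] := hit; have [st _] := hr T.
    have sT' : sigma w <= T%:R.
      have /andP[_ /ltW h] := truncn_itv s0.
      by apply: (le_trans h); rewrite ler_nat.
    rewrite /X (stopped_at_hit hit sT' st).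
    by have [_ -> _] := hit.
have := has_mean_scale (u c)^-1 meanE; rewrite mulr1 uc.
apply: has_mean_ae; apply: aeW => w.
by rewrite mulrC mulfK// -uc gt_eqF.
Qed.

End occupation_laplace.

(** * The exponential law from its Laplace transform *)

Section moments.
Context {R : realType}.

Lemma mul_geometric_le (r : R) n : 0 <= r -> r < 1 -> (1 - r) * (n.+1%:R * r ^+ n) <= 1 - r ^+ n.+1.
Proof.
move=> r0 r1; elim: n => [|n IH]; first by rewrite expr0 expr1 !mulr1.
have rn : 0 <= r ^+ n.+1 by rewrite exprn_ge0.
have rn1 : r ^+ n.+1 <= 1 by rewrite exprn_ile1// ltW.
have -> : (1 - r) * (n.+2%:R * r ^+ n.+1) =
    r * ((1 - r) * (n.+1%:R * r ^+ n)) + (1 - r) * r ^+ n.+1.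
  by rewrite -[n.+2%:R]natr1 [r ^+ n.+1]exprS; ring.
apply: (@le_trans _ _ (r * (1 - r ^+ n.+1) + (1 - r) * r ^+ n.+1)).
  by rewrite lerD2r ler_wpM2l.
rewrite [r ^+ n.+2]exprS.
have : r ^+ n.+1 * (1 - r) <= 1 * (1 - r) by rewrite ler_wpM2r// subr_ge0 ltW.
lra.
Qed.

Lemma bernoulli_pow (x : R) n : 0 <= x <= 1 -> 1 - n%:R * x <= (1 - x) ^+ n.
Proof.
move=> /andP[x0 x1]; elim: n => [|n IH]; first by rewrite expr0 mul0r subr0.
rewrite exprS -natr1; apply: (@le_trans _ _ ((1 - x) * (1 - n%:R * x))).
  have : 0 <= n%:R * x * x by rewrite !mulr_ge0.
  lra.
by rewrite ler_wpM2l// subr_ge0.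
Qed.

(** Polynomials converging on [0, 1] to the indicator of [0, a[; the factor
    [n.+1] makes them vanish at [a] as well. *)
Definition step_exponent (a : R) n := Num.trunc (n.+1%:R / a ^+ (2 * n)).
Definition step_poly (a x : R) n := (1 - x ^+ (2 * n)) ^+ step_exponent a n.

Lemma step_poly_01 a x n : 0 <= x <= 1 -> 0 <= step_poly a x n <= 1.
Proof.
move=> /andP[x0 x1]; have xn : 0 <= x ^+ (2 * n) <= 1.
  by rewrite exprn_ge0//= exprn_ile1.
case/andP: xn => xn0 xn1.
by rewrite exprn_ge0/= ?exprn_ile1 ?subr_ge0// lerBlDr lerDl.
Qed.

Lemma step_poly_cvg a x : 0 < a -> 0 <= x <= 1 ->
  step_poly a x n @[n --> \oo] --> ((x < a)%R%:R : R).
Proof.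
move=> a0 /andP[x0 x1].
have xn01 n : 0 <= x ^+ (2 * n) <= 1 by rewrite exprn_ge0//= exprn_ile1.
have an0 n : 0 < a ^+ (2 * n) by rewrite exprn_gt0.
have N_itv n : (step_exponent a n)%:R <= n.+1%:R / a ^+ (2 * n) < (step_exponent a n).+1%:R.
  by apply: truncn_itv; rewrite divr_ge0// ltW.
have [xa|ax] := ltP x a.
  pose r := x / a.
  have r0 : 0 <= r by rewrite divr_ge0// ltW.
  have r1 : r < 1 by rewrite ltr_pdivrMr// mul1r.
  apply: (@squeeze_cvgr _ _ _ _ (fun n => 1 - r ^+ n / (1 - r)) (fun=> 1)).
  - apply: nearW => n; have /andP[_ ->] := step_poly_01 a n (introT andP (conj x0 x1)).
    rewrite andbT; apply: le_trans (bernoulli_pow (step_exponent a n) (xn01 n)).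
    rewrite lerD2l lerN2; have /andP[h _] := N_itv n.
    have /andP[xn0 _] := xn01 n.
    apply: le_trans (ler_wpM2r xn0 h) _.
    have -> : n.+1%:R / a ^+ (2 * n) * x ^+ (2 * n) = n.+1%:R * r ^+ n * r ^+ n.
      rewrite -!mulrA; congr (_ * _); rewrite /r !expr_div_n mulnC !exprM.
      by field; rewrite expf_neq0// gt_eqF.
    rewrite mulrC; apply: ler_wpM2l; first by rewrite exprn_ge0.
    rewrite -[leRHS]mul1r ler_pdivlMr ?subr_gt0// mulrC.
    apply: le_trans (mul_geometric_le n r0 r1) _.
    by rewrite lerBlDr lerDl exprn_ge0.
  - rewrite -[X in _ --> X]subr0; apply: cvgB; first exact: cvg_cst.
    rewrite -(mul0r (1 - r)^-1); apply: cvgM; last exact: cvg_cst.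
    by apply: cvg_expr; rewrite ger0_norm.
  - exact: cvg_cst.
apply: (@squeeze_cvgr _ _ _ _ (fun=> 0) (fun n => expR (- n%:R))).
- apply: nearW => n; have /andP[-> _] := step_poly_01 a n (introT andP (conj x0 x1)).
  have /andP[xn0 xn1] := xn01 n.
  rewrite /=; apply: (@le_trans _ _ (expR (- x ^+ (2 * n)) ^+ step_exponent a n)).
    rewrite lerXn2r ?nnegrE ?subr_ge0 ?expR_ge0//.
    exact: expR_ge1Dx.
  rewrite -expRM_natl ler_expR mulrN lerN2.
  have /andP[_ h] := N_itv n.
  have xa1 : 1 <= x ^+ (2 * n) / a ^+ (2 * n).
    by rewrite ler_pdivlMr// mul1r lerXn2r ?nnegrE// ltW.
  have : n.+1%:R / a ^+ (2 * n) * x ^+ (2 * n) <= (step_exponent a n).+1%:R * x ^+ (2 * n).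
    by apply: ler_wpM2r => //; exact: ltW.
  rewrite -[(step_exponent a n).+1%:R]natr1 mulrDl mul1r -mulrA (mulrC _^-1).
  have : n.+1%:R * 1 <= n.+1%:R * (x ^+ (2 * n) / a ^+ (2 * n)) by rewrite ler_wpM2l.
  rewrite mulr1 -[n.+1%:R]natr1; lra.
- exact: cvg_cst.
- exact: (cvg_comp _ _ (@cvgr_idn R) (@cvgr_expR R)).
Qed.

Variables m1 m2 : probability (measurableTypeR R) R.
Variable v : R -> R.
Hypotheses (mv : measurable_fun setT v) (v01 : forall x, 0 <= v x <= 1).

(** Equality of the moments of [v] extends to its polynomials, and by bounded
    convergence of [step_poly] to the indicator of [v < a]. *)
Lemma moments_determine (a : R) : 0 < a ->
  (forall n, \int[m1]_x (v x ^+ n) = \int[m2]_x (v x ^+ n)) ->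
  m1 [set x | v x < a] = m2 [set x | v x < a].
Proof.
move=> a0 mom.
have mpow (c : R) n : measurable_fun setT (fun x => c * v x ^+ n).
  by apply: measurable_funM => //; exact: measurable_funX.
have ipow (m : probability (measurableTypeR R) R) c n :
    m.-integrable setT (EFin \o (fun x => c * v x ^+ n)).
  apply: (@bounded_integrable _ _ _ m _ `|c| (mpow c n)) => x.
  have /andP[vx0 vx1] := v01 x.
  rewrite normrM ler_piMr// normrX ger0_norm// exprn_ile1//.
have isum (m : probability (measurableTypeR R) R) (c : nat -> R) k :
    m.-integrable setT (EFin \o (fun x => \sum_(i < k) c i * v x ^+ i)).
  elim: k => [|k IH].
    rewrite (_ : _ \o _ = cst 0%E); first exact: integrable0.
    by apply/funext => x /=; rewrite big_ord0.
  rewrite (_ : _ \o _ = (EFin \o (fun x => (\sum_(i < k) c i * v x ^+ i)%R)) \+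
      (EFin \o (fun x => (c k * v x ^+ k)%R)))%E.
    exact: (integrableD measurableT IH (ipow m (c k) k)).
  by apply/funext => x /=; rewrite big_ord_recr EFinD.
have sumE (c : nat -> R) k : \int[m1]_x (\sum_(i < k) c i * v x ^+ i) =
    \int[m2]_x (\sum_(i < k) c i * v x ^+ i).
  elim: k => [|k IH].
    by under eq_Rintegral do rewrite big_ord0;
       under [RHS]eq_Rintegral do rewrite big_ord0; rewrite !Rintegral_cst// !mul0r.
  have split_last (m : probability (measurableTypeR R) R) :
      \int[m]_x (\sum_(i < k.+1) c i * v x ^+ i) =
      \int[m]_x (\sum_(i < k) c i * v x ^+ i) + c k * \int[m]_x (v x ^+ k).
    rewrite (_ : (fun x => _) = (fun x => \sum_(i < k) c i * v x ^+ i + c k * v x ^+ k)).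
      rewrite (RintegralD measurableT (isum m c k) (ipow m (c k) k)).
      congr (_ + _); apply: RintegralZl => //.
      rewrite (_ : _ \o _ = EFin \o (fun x => 1 * v x ^+ k)); first exact: ipow.
      by apply/funext => x /=; rewrite mul1r.
    by apply/funext => x; rewrite big_ord_recr.
  by rewrite !split_last IH mom.
have polyE (p : {poly R}) : \int[m1]_x p.[v x] = \int[m2]_x p.[v x].
  by under eq_Rintegral do rewrite horner_coef;
     under [RHS]eq_Rintegral do rewrite horner_coef; exact: (sumE (fun i => p`_i)).
have stepE n : \int[m1]_x step_poly a (v x) n = \int[m2]_x step_poly a (v x) n.
  have := polyE ((1 - 'X^(2 * n)) ^+ step_exponent a n).
  by under eq_Rintegral do rewrite !hornerE;
     under [RHS]eq_Rintegral do rewrite !hornerE.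
have mstep n : measurable_fun setT (fun x => step_poly a (v x) n).
  by apply: measurable_funX; apply: measurable_funB => //; exact: measurable_funX.
have step1 n x : `|step_poly a (v x) n| <= 1.
  by have /andP[h1 h2] := step_poly_01 a n (v01 x); rewrite ger0_norm.
have c1 := @bounded_cvg _ _ _ m1 _ _ 1 mstep step1 (fun x => step_poly_cvg a0 (v01 x)).
have c2 := @bounded_cvg _ _ _ m2 _ _ 1 mstep step1 (fun x => step_poly_cvg a0 (v01 x)).
have mset : measurable [set x | v x < a].
  rewrite (_ : [set x | _] = v @^-1` `]-oo, a[); last first.
    by apply/seteqP; split => x /=; rewrite in_itv.
  by rewrite -[X in measurable X]setTI; exact: mv.
have indE (m : probability (measurableTypeR R) R) :
    m [set x | v x < a] = (\int[m]_x (v x < a)%R%:R)%:E.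
  rewrite -[LHS]fineK ?fin_num_measure//; congr (_%:E).
  rewrite -[X in m X]setIT -integral_indic//; congr fine.
  by apply: eq_integral => x _; rewrite indicE (_ : (x \in _) = (v x < a)%R)//; apply/idP/idP; rewrite inE.
rewrite !indE; congr (_%:E).
have sameE : (fun n => \int[m1]_x step_poly a (v x) n) =
    (fun n => \int[m2]_x step_poly a (v x) n) by apply/funext.
by rewrite sameE in c1; apply: (cvg_unique _ c1 c2).
Qed.

End moments.

Section exponential_law.
Context {R : realType}.
Local Notation mu := (@lebesgue_measure R).

Lemma exponential_probability (kap : R) : 0 < kap ->
  exists m : probability (measurableTypeR R) R,
    forall A, m A = exponential_prob kap A.
Proof.
move=> kap0.
unshelve refine (ex_intro _ (exponential_prob kap : probability (measurableTypeR R) R) _); first exact: kap0.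
by [].
Qed.

Lemma exponential_prob_laplace (kap : R) (m : probability (measurableTypeR R) R) n :
  0 < kap -> (forall A, m A = exponential_prob kap A) ->
  \int[m]_x (expR (- Num.max x 0) ^+ n) = kap / (kap + n%:R).
Proof.
move=> kap0 mE.
have kn0 : 0 < kap + n%:R by rewrite ltr_wpDr.
have mv : measurable_fun setT (fun x : R => expR (- Num.max x 0)).
  apply: measurableT_comp => //; apply: measurableT_comp => //.
  exact: measurable_maxr.
have mf : measurable_fun setT (fun x : R => expR (- Num.max x 0) ^+ n).
  exact: measurable_funX.
have bf (x : R) : `|expR (- Num.max x 0) ^+ n| <= 1.
  rewrite ger0_norm ?exprn_ge0 ?expR_ge0// exprn_ile1 ?expR_ge0//.
  by rewrite -[leRHS]expR0 ler_expR lerNl oppr0 le_max lexx orbT.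
have intf := @bounded_integrable _ _ _ m _ 1 mf bf.
have pdf0 x : 0 <= exponential_pdf kap x by apply: exponential_pdf_ge0; exact: ltW.
rewrite /Rintegral (integral_density (measurable_exponential_pdf kap) pdf0 _ intf)//.
rewrite (_ : (fun x => _) = (fun x => (kap / (kap + n%:R))%:E * (exponential_pdf (kap + n%:R) x)%:E)%E).
  rewrite ge0_integralZl//.
  - by rewrite integral_exponential_pdf// mule1.
  - by apply/measurable_EFinP; exact: measurable_exponential_pdf.
  - by move=> x _; rewrite lee_fin exponential_pdf_ge0// ltW.
  - by rewrite lee_fin divr_ge0// ltW.
apply/funext => x; rewrite -EFinM; congr (_%:E).
have [x0|x0] := leP 0 x; last by rewrite !lt0_exponential_pdf// !mulr0.
rewrite !exponential_pdfE// -expRM_natl.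
have -> : - (kap + n%:R) * x = n%:R * (- x) + (- kap * x) by ring.
by rewrite expRD; field; rewrite gt_eqF.
Qed.

(** At the integers the transform of [Y] gives the moments of [exp(- Y)]. As [Y]
    has only a measurable version, the variable [Z] is read off the version of
    [exp(- Y)] provided by the hypothesis at [lam = 1]. *)
Lemma exponential_of_laplace d (Omega : measurableType d) (P : probability Omega R)
    (kap : R) (Y : Omega -> R) : 0 < kap ->
  {ae P, forall w, 0 <= Y w} ->
  (forall lam, 0 < lam ->
    has_mean P (fun w => expR (- (lam * Y w))) (kap / (kap + lam))) ->
  exponentially_distributed P kap Y.
Proof.
move=> kap0 Y0 YL.
have [Z1 [mZ1 YZ1 _]] := YL _ ltr01.
pose Z w := Num.max (- ln (Z1 w)) 0.
have mZ : measurable_fun setT Z.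
  apply: measurable_maxr => //; apply: measurableT_comp => //.
  by apply: measurableT_comp => //; exact: measurable_ln.
have Z0 w : 0 <= Z w by rewrite le_max lexx orbT.
have YZ : {ae P, forall w, Y w = Z w}.
  apply: filterS2 Y0 YZ1 => w y0 yz.
  by rewrite /Z -yz mul1r expRK opprK; apply/esym/max_idPl.
pose ZR : {RV P >-> R} := mfun_Sub (mem_set mZ).
exists ZR; split=> //.
(* [R] and [measurableTypeR R] have the same measurable sets but different
   displays; [nu] is the law of [Z] on the latter *)
have mZ' : @measurable_fun _ _ Omega (measurableTypeR R) setT Z := mZ.
pose nu : probability (measurableTypeR R) R :=
  distribution P (@mfun_Sub _ _ Omega (measurableTypeR R) Z (mem_set mZ') : {RV P >-> measurableTypeR R}).
have nuE A : distribution P ZR A = nu A by [].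
have [m mE] := exponential_probability kap0.
have Zmean (n : nat) : \int[P]_w (expR (- Z w) ^+ n) = kap / (kap + n%:R).
  case: n => [|n].
    under eq_Rintegral do rewrite expr0.
    rewrite Rintegral_cst// mul1r addr0 divff ?gt_eqF//.
    by rewrite (_ : fine (P setT) = 1)// probability_setT.
  have [Z2 [mZ2 YZ2 iZ2]] := YL _ (ltr0Sn R n).
  rewrite -[RHS]/(fine (kap / (kap + n.+1%:R))%:E) -iZ2; congr fine.
  apply: ae_eq_integral => //.
  - apply/measurable_EFinP; apply: measurable_funX.
    by apply: measurableT_comp => //; apply: measurableT_comp.
  - exact/measurable_EFinP.
  apply: filterS2 YZ YZ2 => w yz yz2 _.
  by rewrite -yz2 yz -expRM_natl mulrN.
pose v (x : R) := expR (- Num.max x 0).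
have mv : measurable_fun setT v.
  apply: measurableT_comp => //; apply: measurableT_comp => //.
  exact: measurable_maxr.
have v01 x : 0 <= v x <= 1.
  by rewrite expR_ge0/= -[leRHS]expR0 ler_expR lerNl oppr0 le_max lexx orbT.
have same_moments n :
    \int[nu]_x (v x ^+ n) = \int[m]_x (v x ^+ n).
  rewrite (exponential_prob_laplace n kap0 mE) -Zmean.
  rewrite /Rintegral ge0_integral_distribution; last first.
  - by move=> x; rewrite lee_fin exprn_ge0 ?expR_ge0.
  - by apply/measurable_EFinP; exact: measurable_funX.
  by congr fine; apply: eq_integral => w _ /=; rewrite /v (max_idPl (Z0 w)).
have same_rays (t : R) : nu `]t, +oo[%classic = m `]t, +oo[%classic.
  have [t0|t0] := leP 0 t.
    have -> : `]t, +oo[%classic = [set x | v x < expR (- t)].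
      apply/seteqP; split => x /=; rewrite in_itv/= andbT /v ltr_expR ltrN2.
        by move=> tx; rewrite lt_max tx.
      by rewrite lt_max => /orP[//|]; rewrite ltNge t0.
    have := @moments_determine _ (nu) m v mv v01 _ (expR_gt0 (- t)) same_moments.
    exact.
  transitivity (1%E : \bar R).
    rewrite -[LHS]/(P (Z @^-1` `]t, +oo[)) (_ : _ @^-1` _ = setT) ?probability_setT//.
    apply/seteqP; split => // w _ /=; rewrite in_itv/= andbT.
    exact: lt_le_trans t0 (Z0 w).
  rewrite mE -(integral_exponential_pdf kap0) /exponential_prob.
  rewrite [RHS]integral_mkcond; apply: eq_integral => x _.
  rewrite patchE; case: ifPn => //; rewrite notin_setE/= in_itv/= andbT => /negP.
  by rewrite -leNgt => xt; rewrite lt0_exponential_pdf// (le_lt_trans xt).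
move=> A mA; rewrite nuE -mE.
apply: (@measure_unique _ R (measurableTypeR R) (RGenOInfty.G (R:=R)) (fun k : nat => `](- k%:R), +oo[%classic) _ _ _ _ nu m _ _ A mA).
- exact: RGenOInfty.measurableE.
- move=> _ _ [s ->] [t ->]; exists (Num.max s t).
  by apply/seteqP; split => x /=; rewrite !in_itv/= !andbT gt_max;
     [move=> [-> ->]|move=> /andP].
- by move=> k; exists (- k%:R).
- apply/seteqP; split => // x _; exists (Num.trunc `|x|).+1 => //=.
  rewrite in_itv/= andbT ltrNl (le_lt_trans (ler_norm _))// normrN.
  by have /andP[] := truncn_itv (normr_ge0 x).
- by move=> _ [t ->]; exact: same_rays.
- by move=> k; rewrite (le_lt_trans (probability_le1 _ _)) ?ltry.
Qed.

End exponential_law.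

(** * Scale function and time change *)

Section primitive.
Context {R : realType}.
Notation mu := (@lebesgue_measure R).
Implicit Types (g : R -> R) (x y : R).

(** The primitive vanishing at the origin. It is the form in which the scale
    function and the time change are differentiated. *)
Definition primitive g x : R :=
  if 0 <= x then \int[mu]_(t in `[0, x]) g t else - \int[mu]_(t in `[x, 0]) g t.

Lemma continuous_integrable g x y : continuous g -> mu.-integrable `[x, y] (EFin \o g).
Proof.
move=> cg; apply: continuous_compact_integrable; first exact: segment_compact.
exact: continuous_subspaceT.
Qed.

Lemma integral_primitive g x y : continuous g -> x <= y ->
  \int[mu]_(t in `[x, y]) g t = primitive g y - primitive g x.
Proof.
move=> cg.
have split_at (u v w : R) : u <= v -> v <= w ->
    \int[mu]_(t in `[u, w]) g t =
    \int[mu]_(t in `[u, v]) g t + \int[mu]_(t in `[v, w]) g t.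
  move=> uv vw.
  have i1 := @continuous_integrable g u w cg.
  have := Rintegral_itvB i1 (_ : (BLeft u <= BRight v)%O) (_ : (BRight v <= BRight w)%O).
  rewrite !bnd_simp => /(_ uv vw).
  rewrite Rintegral_itv_obnd_cbnd; first by move=> <-; rewrite addrC subrK.
  apply: (integrableS _ _ _ (@continuous_integrable g v w cg)) => //.
  exact: subset_itv_oc_cc.
rewrite /primitive; case: (leP 0 x) => x0; case: (leP 0 y) => y0 xy.
- by rewrite (split_at 0 x y)// addrC addKr.
- by have := lt_le_trans y0 (le_trans x0 xy); rewrite ltxx.
- by rewrite (split_at x 0 y) ?(ltW x0)// opprK addrC.
- by rewrite (split_at x y 0) ?(ltW y0)//; ring.
Qed.

Lemma is_derive_primitive g x : continuous g -> is_derive x (1:R) (primitive g) (g x).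
Proof.
move=> cg; pose A := x - 1.
have xx1 : x < x + 1 by rewrite ltrDl.
have Ax : A < x by rewrite /A; lra.
have [d1 d2] := @continuous_FTC1_closed _ g A x (x + 1) xx1
  (continuous_integrable _ _ cg) Ax (cg x).
have d : is_derive x (1:R) (fun z => \int[mu]_(t in `[A, z]) g t + primitive g A) (g x).
  rewrite -[g x]addr0; apply: is_deriveD.
  by apply: DeriveDef; [exact: d1|rewrite -derive1E; exact: d2].
apply: near_eq_is_derive d.
near=> z; rewrite integral_primitive ?subrK//.
by apply: ltW; near: z; exact: lt_nbhsr.
Unshelve. all: by end_near. Qed.

Lemma continuous_primitive g : continuous g -> continuous (primitive g).
Proof.
move=> cg x; apply: differentiable_continuous; apply/derivable1_diffP.
by have [] := is_derive_primitive x cg.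
Qed.

Lemma primitive0 g : primitive g 0 = 0.
Proof. by rewrite /primitive lexx set_itv1 Rintegral_set1. Qed.

Lemma primitive_increasing g : continuous g -> (forall x, 0 < g x) ->
  {homo primitive g : x y / x < y}.
Proof.
move=> cg g0 x y xy; rewrite -subr_gt0.
have [z _ ->] := MVT xy (fun z _ => is_derive_primitive z cg)
  (continuous_subspaceT (continuous_primitive cg)).
by rewrite mulr_gt0// subr_gt0.
Qed.

(** Change of variables along a primitive: its derivative being everywhere
    defined and continuous, the side conditions at the end points disappear. *)
Lemma primitive_substitution g G x y : continuous g -> (forall z, 0 < g z) -> x <= y ->
  {within `[primitive g x, primitive g y], continuous G} ->
  (\int[mu]_(r in `[primitive g x, primitive g y]) (G r)%:E =
   \int[mu]_(z in `[x, y]) (G (primitive g z) * g z)%:E)%E.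
Proof.
move=> cg g0 xy cG.
have dF : (primitive g)^`()%classic = g.
  by apply/funext => z; rewrite derive1E; have d := is_derive_primitive z cg; exact: derive_val.
rewrite (integration_by_substitution_increasing xy)//.
- by apply: eq_integral => z _; rewrite dF.
- by move=> u v _ _; exact: primitive_increasing.
- by rewrite dF => z _; exact: cg.
- by rewrite dF; apply/cvg_ex; exists (g x); apply: cvg_at_right_filter; exact: cg.
- by rewrite dF; apply/cvg_ex; exists (g y); apply: cvg_at_left_filter; exact: cg.
- split; first by move=> z _; have [] := is_derive_primitive z cg.
    by apply: cvg_at_right_filter; exact: continuous_primitive.
  by apply: cvg_at_left_filter; exact: continuous_primitive.
Qed.

End primitive.

Section brox_paths.
Context {R : realType}.
Notation mu := (@lebesgue_measure R).
Variable W : R -> R.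
Hypothesis cW : continuous W.

Let expW := fun x : R => expR (W x).
Let expW_continuous : continuous expW.
Proof. by move=> x; apply: (@cvg_comp _ _ _ W expR _ _ _ _ (@continuous_expR R _)); exact: cW. Qed.

Lemma continuous_scale : continuous (scale W).
Proof. exact: (continuous_primitive expW_continuous). Qed.

Lemma scale_increasing : {homo scale W : x y / x < y}.
Proof. by apply: (primitive_increasing expW_continuous) => x; exact: expR_gt0. Qed.

Hypothesis hs : bijective (scale W).

Lemma scaleK : cancel (scale W) (scale_inv W).
Proof.
move=> x; apply: pinvKV; last exact: in_setT.
by move=> u v _ _; exact: (bij_inj hs).
Qed.

Lemma scale_invK : cancel (scale_inv W) (scale W).
Proof. by move=> r; have [s' _ s'K] := hs; rewrite -[r]s'K scaleK. Qed.

Lemma continuous_scale_inv : continuous (scale_inv W).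
Proof.
move=> r; rewrite -[r]scale_invK.
suff /nbhs_singleton : {near scale W (scale_inv W r), continuous (scale_inv W)} by [].
apply: near_can_continuous; near=> z; first exact: scaleK.
exact: continuous_scale.
Unshelve. all: by end_near. Qed.

(** [be] is a continuous function on the whole line that extends the trajectory
    [beta], itself controlled only on the half-line. *)
Variables (be beta : R -> R).
Hypotheses (cbe : continuous be) (be_beta : forall t, 0 <= t -> be t = beta t).

(** The derivative of the time change. *)
Let speed u := expR (- 2 * W (scale_inv W (be u))).

Let speed_gt0 u : 0 < speed u. Proof. exact: expR_gt0. Qed.

Let position_continuous : continuous (fun u => scale_inv W (be u)).
Proof. by move=> u; apply: (@cvg_comp _ _ _ be (scale_inv W) _ _ _ _ (@continuous_scale_inv _)); exact: cbe. Qed.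

Let speed_continuous : continuous speed.
Proof.
move=> u; apply: (@cvg_comp _ _ _ _ expR _ _ _ _ (@continuous_expR R _)).
apply: cvgM; first exact: cvg_cst.
by apply: (@cvg_comp _ _ _ _ W _ _ _ _ (@cW _)); exact: position_continuous.
Qed.

Let T := primitive speed.

Let T_inj : injective T.
Proof.
move=> u v uv; apply/eqP; case: (ltgtP u v) => // /(primitive_increasing speed_continuous speed_gt0);
  by rewrite -/T uv ltxx.
Qed.

Let T_ge0 u : 0 <= u -> 0 <= T u.
Proof.
rewrite le_eqVlt => /orP[/eqP <-|u0]; first by rewrite /T primitive0.
by rewrite -(primitive0 speed) ltW// (primitive_increasing speed_continuous).
Qed.

Lemma time_changeE u : 0 <= u -> time_change W beta u = T u.
Proof.
move=> u0; rewrite /T /primitive u0 /time_change; apply: eq_Rintegral => t.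
by rewrite inE/= in_itv/= => /andP[t0 _]; rewrite /speed be_beta.
Qed.

Lemma time_changeK u : 0 <= u -> time_change_inv W beta (T u) = u.
Proof.
move=> u0; rewrite -time_changeE//; apply: pinvKV; last by rewrite inE/= in_itv/= u0.
move=> s t; rewrite !inE/= !in_itv/= !andbT => s0 t0.
by rewrite !time_changeE// => /T_inj.
Qed.

Lemma brox_time_change u : 0 <= u -> brox W beta (T u) = scale_inv W (be u).
Proof. by move=> u0; rewrite /brox time_changeK// be_beta. Qed.

(** Every time before [T sigma] is [T u] for some [u < sigma], at which [beta],
    hence the diffusion, has not yet reached the level. *)
Lemma first_passage_brox b sigma : first_hit (scale W b) beta sigma ->
  first_passage (brox W beta) b = (T sigma)%:E.
Proof.
move=> [s0 bs lt_s]; apply/eqP; rewrite eq_le; apply/andP; split.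
  apply: ereal_inf_lbound; exists (T sigma) => //; split; first exact: T_ge0.
  by rewrite brox_time_change// be_beta// bs scaleK.
apply: le_ereal_inf_tmp => _ [t [t0 Xt] <-]; rewrite lee_fin leNgt; apply/negP => ts.
have [||u] := @IVT _ T 0 sigma t s0.
- by apply: continuous_subspaceT; exact: continuous_primitive.
- by rewrite ge_min le_max /T primitive0 t0 (ltW ts) orbT.
rewrite in_itv/= => /andP[u0 us] ut.
have {}us : u < sigma.
  by rewrite lt_neqAle us andbT; apply/eqP => us'; rewrite -ut us' ltxx in ts.
have := lt_s _ u0 us; rewrite -be_beta// -[be u]scale_invK -brox_time_change// ut Xt.
by rewrite ltxx.
Qed.

(** The substitution [t = T u]. *)
Lemma brox_additive_functional f sigma : continuous f -> 0 <= sigma ->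
  (\int[mu]_(t in `[0%R, T sigma]) (f (brox W beta t))%:E =
   \int[mu]_(u in `[0%R, sigma]) (f (scale_inv W (be u)) * speed u)%:E)%E.
Proof.
move=> cf s0.
have T0 : T 0 = 0 by exact: primitive0.
pose G t := f (scale_inv W (be (time_change_inv W beta t))).
have onto t : t \in `[0, T sigma] -> exists2 u, 0 <= u <= sigma & T u = t.
  rewrite in_itv/= => /andP[t0 ts].
  have [||u] := @IVT _ T 0 sigma t s0.
  - by apply: continuous_subspaceT; exact: continuous_primitive.
  - by rewrite ge_min le_max T0 t0 ts orbT.
  by rewrite in_itv/= => us ut; exists u.
transitivity (\int[mu]_(t in `[0%R, T sigma]) (G t)%:E)%E.
  apply: eq_integral => t; rewrite inE/= => /onto[u /andP[u0 _] <-].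
  by rewrite brox_time_change// /G time_changeK.
rewrite -[X in `[X, _]]T0 (primitive_substitution speed_continuous speed_gt0 s0).
  apply: eq_integral => u; rewrite inE/= in_itv/= => /andP[u0 _].
  by rewrite /G time_changeK.
rewrite -/T T0.
have cinv : {within `[0, T sigma], continuous (time_change_inv W beta)}.
  rewrite -[X in `[X, _]]T0; apply: segment_can_le_continuous => //.
  - by apply: continuous_subspaceT; exact: continuous_primitive.
  - by move=> u; rewrite in_itv/= => /andP[u0 _]; exact: time_changeK.
have cG : continuous (fun u => f (scale_inv W (be u))).
  by move=> u; apply: (@cvg_comp _ _ _ _ f _ _ _ _ (@cf _)); exact: position_continuous.
apply: (@within_continuous_comp _ _ _ _ (time_change_inv W beta)
  (fun u => f (scale_inv W (be u))) _ cinv) => t _; exact: cG.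
Qed.

End brox_paths.

(** * Local time as the limit of tent averages *)

Section tent_average.
Context {R : realType}.
Notation mu := (@lebesgue_measure R).
Implicit Types (x y e lam : R).

(** [pos z ^+ 2] has a derivative at the kink too, since its Taylor remainder of
    order one is at most [h ^+ 2]. *)
Lemma is_derive_pos_sqr k x : is_derive x (1:R) (fun z => pos (z - k) ^+ 2) (2 * pos (x - k)).
Proof.
have bound h : `|pos (x + h - k) ^+ 2 - pos (x - k) ^+ 2 - 2 * pos (x - k) * h| <= h ^+ 2.
  rewrite (_ : x + h - k = x - k + h); last by ring.
  rewrite /pos; case: (leP (x - k) 0) => x0; case: (leP (x - k + h) 0) => xh0.
  - by rewrite expr0n/= mulr0 mul0r !subr0 normr0 sqr_ge0.
  - by rewrite expr0n/= mulr0 mul0r !subr0 ger0_norm ?sqr_ge0//; nra.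
  - by rewrite expr0n/= sub0r ler_norml; apply/andP; split; nra.
  - by rewrite (_ : _ - _ - _ = h ^+ 2) ?ger0_norm ?sqr_ge0//; ring.
suff dq : (fun h => h^-1 *: (pos (h *: 1 + x - k) ^+ 2 - pos (x - k) ^+ 2)) @ 0^' -->
    (2 * pos (x - k)).
  by apply: DeriveDef; [apply/cvg_ex; exists (2 * pos (x - k))|apply/cvg_lim].
apply/cvgrPdist_le => e e0; near=> h.
have h0 : h != 0 by near: h; exact: nbhs_dnbhs_neq.
have he : `|h| <= e by near: h; apply: dnbhs0_le.
rewrite distrC (_ : h *: 1 + x - k = x + h - k); last by rewrite /GRing.scale/=; ring.
rewrite (_ : _ - _ = h^-1 * (pos (x + h - k) ^+ 2 - pos (x - k) ^+ 2 - 2 * pos (x - k) * h)).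
  rewrite normrM normfV ler_pdivrMl ?normr_gt0//.
  apply: (le_trans (bound h)); rewrite -real_normK ?num_real// expr2.
  by rewrite ler_pM2l ?normr_gt0.
by rewrite /GRing.scale/=; field.
Unshelve. all: by end_near. Qed.

Lemma is_derive_tent_slope y e x : 0 < e ->
  is_derive x (1:R) (tent_slope y e) (tent y e x).
Proof.
move=> e0.
have d0 := is_derive_pos_sqr y x.
have d1 := is_derive_pos_sqr (y + e) x.
have d2 := is_derive_pos_sqr (y + 2 * e) x.
rewrite (_ : tent_slope y e = (fun z => (pos (z - y) ^+ 2 - 2 * pos (z - (y + e)) ^+ 2
    + pos (z - (y + 2 * e)) ^+ 2) * (2 * e ^+ 2)^-1)); last first.
  by apply/funext => z; rewrite /tent_slope !opprD !addrA.
apply: is_derive_eq.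
rewrite /tent !opprD !addrA /GRing.scale/=.
by field; rewrite gt_eqF.
Qed.

Lemma integral_tent y e : 0 < e -> \int[mu]_(r in `[y, y + 2 * e]) tent y e r = 1.
Proof.
move=> e0; have yy : y < y + 2 * e by rewrite ltrDl mulr_gt0.
have cs x : {for x, continuous (tent_slope y e)}.
  apply: differentiable_continuous; apply/derivable1_diffP.
  by have [] := is_derive_tent_slope y x e0.
rewrite /Rintegral (@continuous_FTC2 _ _ (tent_slope y e) _ _ yy).
- rewrite /tent_slope /pos/= subrr (_ : y + 2 * e - y = 2 * e); last by ring.
  rewrite (_ : 2 * e - e = e); last by ring.
  rewrite subrr sub0r maxxx (max_idPl (ltW e0)) (max_idPl (mulr_ge0 _ (ltW e0)))//.
  rewrite (max_idPr (_ : - e <= 0)) ?oppr_le0 ?(ltW e0)//.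
  rewrite (max_idPr (_ : 0 - 2 * e <= 0)); last by lra.
  by rewrite expr0n/=; field; rewrite gt_eqF.
- by apply: continuous_subspaceT; exact: continuous_tent.
- split; first by move=> z _; have [] := is_derive_tent_slope y z e0.
    by apply: cvg_at_right_filter; exact: cs.
  by apply: cvg_at_left_filter; exact: cs.
- by move=> z _; rewrite derive1E; have d := is_derive_tent_slope y z e0; exact: derive_val.
Qed.

Lemma tent_potential_le y e x : 0 < e -> x <= y + 2 * e -> tent_potential y e x <= 2 * e.
Proof.
move=> e0 xe; rewrite /tent_potential.
rewrite [pos (x - y - 2 * e)](max_idPr _); last by lra.
have p1 : 0 <= pos (x - y) <= 2 * e by rewrite le_max lexx orbT ge_max; apply/andP; split; lra.
have p2 : 0 <= pos (x - y - e) by rewrite le_max lexx orbT.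
have e6 : 0 < 6 * e ^+ 2 by have := exprn_gt0 2 e0; lra.
rewrite ler_pdivrMr// expr0n/= addr0.
have /andP[p10 p1e] := p1.
have h1 : pos (x - y) ^+ 3 <= (2 * e) ^+ 3 by rewrite lerXn2r ?nnegrE// mulr_ge0// ltW.
have h2 : 0 <= pos (x - y - e) ^+ 3 by exact: exprn_ge0.
have h3 : 0 <= e ^+ 3 by rewrite exprn_ge0// ltW.
rewrite (_ : 2 * e * (6 * e ^+ 2) = 12 * e ^+ 3); last by ring.
rewrite (_ : (2 * e) ^+ 3 = 8 * e ^+ 3) in h1; last by ring.
lra.
Qed.

(** The tents form an approximate identity at [y], and on their support the
    denominator of [tent_rate] lies between [1] and [1 + 4 lam e]. *)
Lemma tent_rate_average y lam m : 0 < lam -> continuous m ->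
  \int[mu]_(r in `[y, y + 2 * e]) (tent_rate y lam e r * m r) @[e --> 0^'+] --> lam * m y.
Proof.
move=> lam0 cm; apply/cvgrPdist_le => d d0.
pose D := d / lam.
have D2 : 0 < D / 2 by rewrite !divr_gt0.
have /cvgrPdist_le/(_ _ D2)/nbhs_ballP[rho /= rho0 hrho] := cm y.
have K0 : 0 < 8 * lam * (`|m y| + 1) by rewrite !mulr_gt0// ltr_wpDl.
near=> e.
have e0 : 0 < e by near: e; exact: nbhs_right_gt.
have erho : 2 * e < rho.
  rewrite mulrC -ltr_pdivlMr//; near: e; apply: nbhs_right_lt; exact: divr_gt0.
have eK : e * (8 * lam * (`|m y| + 1)) <= D.
  rewrite -ler_pdivlMr//; near: e; apply: nbhs_right_le; rewrite !divr_gt0//.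
have ct : continuous (fun r => tent_rate y lam e r * m r).
  by move=> r; apply: cvgM; [exact: continuous_tent_rate|exact: cm].
have lamm : lam * m y = \int[mu]_(r in `[y, y + 2 * e]) (tent y e r * (lam * m y)).
  by rewrite RintegralZr ?integral_tent ?mul1r//; apply: continuous_integrable; exact: continuous_tent.
have ct2 : continuous (fun r => tent y e r * (lam * m y)).
  by move=> r; apply: cvgM; [exact: continuous_tent|exact: cvg_cst].
rewrite [X in `|X - _|]lamm -RintegralB//; [|exact: continuous_integrable..].
apply: le_trans (le_normr_Rintegral _ _) _ => //.
  apply: continuous_integrable => r; apply: cvgB; [exact: ct2|exact: ct].
have -> : d = \int[mu]_(r in `[y, y + 2 * e]) (tent y e r * d).
  by rewrite RintegralZr ?integral_tent ?mul1r//; apply: continuous_integrable; exact: continuous_tent.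
apply: le_Rintegral => //.
- apply: continuous_integrable => r; apply: (@cvg_comp _ _ _ _ (fun z : R => `|z|) _ _ _ _ (@norm_continuous _ _ _)).
  by apply: cvgB; [exact: ct2|exact: ct].
- by apply: continuous_integrable => r; apply: cvgM; [exact: continuous_tent|exact: cvg_cst].
move=> r; rewrite /= in_itv/= => /andP[yr ry].
pose U := tent_potential y e r.
have U0 : 0 <= U by exact: tent_potential_ge0.
have Ue : U <= 2 * e by exact: tent_potential_le.
have lU : 0 <= 2 * lam * U by exact: (mulr_ge0 (mulr_ge0 (ler0n _ _) (ltW lam0)) U0).
pose q := (1 + 2 * lam * U)^-1.
have q0 : 0 <= q by rewrite invr_ge0 addr_ge0.
have q1 : q <= 1 by rewrite invf_le1 ?lerDl// ltr_wpDr.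
have qU : 1 - q <= 2 * lam * U.
  rewrite lerBlDr -lerBlDl /q.
  have q' : 0 < 1 + 2 * lam * U by rewrite ltr_wpDr.
  rewrite -[leRHS]mul1r ler_pdivlMr// (_ : _ * _ = 1 - (2 * lam * U) ^+ 2); last by ring.
  by rewrite lerBlDr lerDl sqr_ge0.
rewrite (_ : _ - _ = tent y e r * (lam * (m y - q * m r))); last first.
  by rewrite /tent_rate -/U -/q; ring.
rewrite normrM ger0_norm ?tent_ge0// ler_wpM2l ?tent_ge0//.
rewrite normrM gtr0_norm// -ler_pdivlMl// [_^-1 * d]mulrC -/D.
have -> : m y - q * m r = (1 - q) * m y + q * (m y - m r) by ring.
apply: le_trans (ler_normD _ _) _; rewrite !normrM (ger0_norm q0) ger0_norm ?subr_ge0//.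
have h1 : q * `|m y - m r| <= D / 2.
  apply: (@le_trans _ _ (1 * `|m y - m r|)); first exact: ler_wpM2r.
  rewrite mul1r; apply: hrho; rewrite /ball/= distrC ger0_norm ?subr_ge0//; lra.
have h2 : (1 - q) * `|m y| <= D / 2.
  have : (1 - q) * `|m y| <= 2 * lam * U * `|m y| by exact: ler_wpM2r.
  have : 2 * lam * U * `|m y| <= 2 * lam * (2 * e) * `|m y|.
    by rewrite ler_wpM2r// ler_wpM2l// mulr_ge0// ltW.
  have : 0 <= lam * e by rewrite mulr_ge0// ltW.
  rewrite (_ : e * _ = 8 * (lam * e) * `|m y| + 8 * (lam * e)) in eK; last by ring.
  rewrite (_ : 2 * lam * (2 * e) * _ = 4 * (lam * e) * `|m y|); last by ring.
  lra.
lra.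
Unshelve. all: by end_near. Qed.

End tent_average.

Section brox_local_time.
Context {R : realType}.
Notation mu := (@lebesgue_measure R).

Lemma local_time_continuous (X : R -> R) l t : is_local_time X l -> 0 <= t ->
  continuous (l t).
Proof.
move=> hl t0 x.
have /subspace_continuousP/(_ (t, x) t0) := local_time_cont hl.
apply: (@cvg_comp _ _ _ (fun z => (t, z)) (fun p => l p.1 p.2)) => U /=.
move=> [[A1 A2] /= [nA1 nA2] hU]; apply: filterS nA2 => z A2z.
by apply: (hU (t, z)) => //; split => //=; exact: nbhs_singleton.
Qed.

Variables (W be beta : R -> R) (l : R -> R -> R) (sigma y lam e : R).
Hypotheses (cW : continuous W) (hs : bijective (scale W)) (cbe : continuous be)
  (be_beta : forall t, 0 <= t -> be t = beta t)
  (hl : is_local_time (brox W beta) l)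
  (s0 : 0 <= sigma) (lam0 : 0 < lam) (e0 : 0 < e).

Let t := primitive (fun u => expR (- 2 * W (scale_inv W (be u)))) sigma.

(** The occupation formula for [F(x) = tent_rate(s(x)) e^(2 W(x))]. In time, the
    factor [e^(2 W)] cancels the speed [e^(- 2 W)] of the time change; in space,
    one factor [e^W] is the derivative of [s] and is used up by the substitution
    [r = s(x)]. *)
Lemma occupation_scale :
  \int[mu]_(u in `[0, sigma]) tent_rate y lam e (beta u) =
  \int[mu]_(r in `[y, y + 2 * e])
    (tent_rate y lam e r * (expR (W (scale_inv W r)) * l t (scale_inv W r))).
Proof.
have cexpW : continuous (fun x => expR (W x)).
  by move=> x; apply: (@cvg_comp _ _ _ W expR _ _ _ _ (@continuous_expR R _)); exact: cW.
have cs := continuous_scale cW.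
have cinv := continuous_scale_inv cW hs.
have sK := scaleK hs; have sK' := scale_invK hs.
have incr := scale_increasing cW.
have ctr := @continuous_tent_rate R y lam lam0 e e0.
have t0 : 0 <= t.
  rewrite /t /primitive s0; apply: Rintegral_ge0 => u _; exact: expR_ge0.
have cl := local_time_continuous hl t0.
pose F x := tent_rate y lam e (scale W x) * expR (2 * W x).
have cF : continuous F.
  move=> x; apply: cvgM.
    by apply: (@cvg_comp _ _ _ (scale W) (tent_rate y lam e) _ _ _ _ (@ctr _)); exact: cs.
  apply: (@cvg_comp _ _ _ (fun x => 2 * W x) expR _ _ _ _ (@continuous_expR R _)).
  by apply: cvgM; [exact: cvg_cst|exact: cW].
have F0 x : 0 <= F x by rewrite mulr_ge0 ?expR_ge0//; exact: tent_rate_ge0.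
have mF : measurable_fun setT F by exact: continuous_measurable_fun.
have := occupation hl t0 mF F0.
rewrite (brox_additive_functional cW hs cbe be_beta cF s0) => E.
rewrite /Rintegral; congr fine.
transitivity (\int[mu]_(u in `[0%R, sigma])
    (F (scale_inv W (be u)) * expR (- 2 * W (scale_inv W (be u))))%:E)%E.
  apply: eq_integral => u; rewrite inE/= in_itv/= => /andP[u0 _].
  by rewrite /F sK' -mulrA -expRD mulNr subrr expR0 mulr1 be_beta.
rewrite E.
pose G r := tent_rate y lam e r * (expR (W (scale_inv W r)) * l t (scale_inv W r)).
pose x0 := scale_inv W y; pose x1 := scale_inv W (y + 2 * e).
have x01 : x0 <= x1.
  rewrite leNgt; apply/negP => /incr; rewrite /x0 /x1 !sK'; have := e0; lra.
transitivity (\int[mu]_(x in `[x0, x1]) (G (scale W x) * expR (W x))%:E)%E.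
  rewrite [RHS]integral_mkcond; apply: eq_integral => x _.
  rewrite patchE; case: ifPn => [_|].
    by rewrite /G /F sK; congr (_%:E); rewrite (mulrDl 1 1) mul1r expRD; ring.
  rewrite notin_setE/= in_itv/= => /negP; rewrite negb_and -!ltNge => xout.
  rewrite /F /tent_rate tent_out ?mulr0 ?mul0r//.
  case/orP: xout => /incr; rewrite /x0 /x1 sK' => h; [left|right]; exact: ltW.
have cG : {within `[scale W x0, scale W x1], continuous G}.
  apply: continuous_subspaceT => r; apply: cvgM; first exact: ctr.
  apply: cvgM.
    by apply: (@cvg_comp _ _ _ (scale_inv W) (fun x => expR (W x)) _ _ _ _ (@cexpW _)); exact: cinv.
  by apply: (@cvg_comp _ _ _ (scale_inv W) (l t) _ _ _ _ (@cl _)); exact: cinv.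
rewrite -(primitive_substitution cexpW (fun x => expR_gt0 (W x)) x01 cG).
have -> : primitive (fun x => expR (W x)) = scale W by [].
by rewrite /x0 /x1 !sK'.
Qed.

End brox_local_time.

(** * The Laplace transform of the local time *)

Section laplace_transform.
Context {R : realType} {d : measure_display} {Omega : measurableType d}.
Notation mu := (@lebesgue_measure R).
Variable P : probability Omega R.
Variables (B : R -> {RV P >-> R}) (W : R -> R) (L : R -> R -> {RV P >-> R}) (a b : R).
Hypotheses (hB : standard_brownian_motion B) (cW : continuous W)
  (hs : bijective (scale W))
  (hL : {ae P, forall w, is_local_time (brox W (B ^~ w)) (fun t x => L t x w)})
  (a0 : 0 < a) (ab : a < b).

Let Y w := L (fine (first_passage (brox W (B ^~ w)) b)) a w.
Let sigma w := xget 0 [set s | first_hit (scale W b) (B ^~ w) s].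

Let cexpW : continuous (fun x => expR (W x)).
Proof. by move=> x; apply: (@cvg_comp _ _ _ W expR _ _ _ _ (@continuous_expR R _)); exact: cW. Qed.

Let incr := scale_increasing cW.

Let sa0 : 0 < scale W a.
Proof. by have := incr a0; rewrite [scale W 0]primitive0. Qed.

Let sab : scale W a < scale W b. Proof. exact: incr. Qed.

Lemma first_hit_sigma : {ae P, forall w, first_hit (scale W b) (B ^~ w) (sigma w)}.
Proof.
apply: filterS (hits_level hB (lt_trans sa0 sab)) => w.
exact: xgetPex.
Qed.

(** [occupation_scale] followed by [tent_rate_average]; the average is taken at
    [y = s(a)], where [s^-1(y) = a]. *)
Lemma occupation_near_level : {ae P, forall w, forall lam, 0 < lam ->
  \int[mu]_(t in `[0, sigma w]) tent_rate (scale W a) lam e (B t w) @[e --> 0^'+] -->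
    lam * (expR (W a) * Y w)}.
Proof.
apply: filterS3 (good_paths hB) hL first_hit_sigma.
move=> w [be [cbe be0] be_beta] hl hit lam lam0.
have [s0 _ _] := hit.
rewrite /Y (first_passage_brox cW hs cbe be_beta hit) /=.
set t := primitive _ _.
have t0 : 0 <= t.
  rewrite /t /primitive s0; apply: Rintegral_ge0 => u _; exact: expR_ge0.
have cinv := continuous_scale_inv cW hs.
pose m r := expR (W (scale_inv W r)) * L t (scale_inv W r) w.
have cm : continuous m.
  move=> r; apply: cvgM.
    by apply: (@cvg_comp _ _ _ (scale_inv W) (fun x => expR (W x)) _ _ _ _ (@cexpW _)); exact: cinv.
  apply: (@cvg_comp _ _ _ (scale_inv W) (fun x => L t x w) _ _ _ _
    (@local_time_continuous _ _ _ _ hl t0 _)); exact: cinv.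
have := @tent_rate_average R (scale W a) lam m lam0 cm.
rewrite {2}/m (scaleK hs); apply: cvg_trans; apply: near_eq_cvg.
near=> e; have e0 : 0 < e by near: e; exact: nbhs_right_gt.
by rewrite (occupation_scale _ cW hs cbe be_beta hl s0 lam0 e0).
Unshelve. all: by end_near. Qed.

(** The occupation formula only gives nonnegativity for almost every level. At
    the level [a] it follows from [occupation_near_level]. *)
Lemma local_time_ge0 : {ae P, forall w, 0 <= Y w}.
Proof.
apply: filterS occupation_near_level => w /(_ _ ltr01); rewrite mul1r => h.
rewrite -(pmulr_rge0 _ (expR_gt0 (W a))).
apply: (cvgr_to_ge h).
near=> e; have e0 : 0 < e by near: e; exact: nbhs_right_gt.
by apply: Rintegral_ge0 => t _; exact: tent_rate_ge0.
Unshelve. all: by end_near. Qed.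

(** [occupation_laplace] along tents whose half-widths tend to [0], by dominated
    convergence. *)
Lemma local_time_laplace lam : 0 < lam ->
  has_mean P (fun w => expR (- (lam * (expR (W a) * Y w))))
    (1 + 2 * lam * (scale W b - scale W a))^-1.
Proof.
move=> lam0; pose D := scale W b - scale W a.
have D0 : 0 < D by rewrite subr_gt0.
pose e n : R := D / 2 * n.+1%:R^-1.
have e0 n : 0 < e n by rewrite !mulr_gt0// ?invr_gt0 ?ltr0n.
have e_cvg : e n @[n --> \oo] --> (0 : R).
  rewrite -(mulr0 (D / 2)); apply: cvgM; first exact: cvg_cst.
  exact: cvg_harmonic.
have eD n : scale W a + 2 * e n <= scale W b.
  have : e n <= D / 2 by rewrite ler_piMr ?divr_ge0 ?(ltW D0)// invf_le1 ?ler1n.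
  by rewrite /D; lra.
pose X n w := expR (- \int[mu]_(t in `[0, sigma w]) tent_rate (scale W a) lam (e n) (B t w)).
apply: (@has_mean_cvg _ _ _ P X _ 1
  (fun n => (1 + 2 * lam * (scale W b - scale W a - e n))^-1)).
- by move=> n; exact: (occupation_laplace hB sa0 lam0 (e0 n) (eD n) first_hit_sigma).
- apply: filterS first_hit_sigma => w _ n; rewrite ger0_norm ?expR_ge0//.
  rewrite -[leRHS]expR0 ler_expR lerNl oppr0; apply: Rintegral_ge0 => t _.
  exact: tent_rate_ge0.
- apply: filterS occupation_near_level => w /(_ _ lam0) h.
  apply: (@cvg_comp _ _ _ _ expR _ _ _ _ (@continuous_expR R _)).
  by apply: cvgN; move/cvg_at_rightP: h; apply.
- apply: cvgV; first by rewrite gt_eqF// ltr_wpDr// !mulr_ge0// ltW.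
  apply: cvgD; first exact: cvg_cst.
  apply: cvgM; first exact: cvg_cst.
  rewrite -[X in _ --> X]subr0; apply: cvgB => //; exact: cvg_cst.
Qed.

End laplace_transform.

(* The first passage time is an extended real, almost surely finite; [fine]
   reads it as a real number. *)
Theorem proposition1 (R : realType) (d : measure_display)
    (Omega : measurableType d) (P : probability Omega R)
    (B : R -> {RV P >-> R}) (W : R -> R) (L : R -> R -> {RV P >-> R}) (a b : R)
    (hB : standard_brownian_motion B)
    (hW : continuous W) (hW0 : W 0 = 0) (hs : bijective (scale W))
    (hL : {ae P, forall w, is_local_time (brox W (B ^~ w)) (fun t x => L t x w)})
    (ha : 0 < a) (hab : a < b) :
  exponentially_distributed P (expR (W a) / (2 * (scale W b - scale W a)))
    (fun w => L (fine (first_passage (brox W (B ^~ w)) b)) a w).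
Proof.
have D0 : 0 < scale W b - scale W a.
  by rewrite subr_gt0 scale_increasing.
have eW := expR_gt0 (W a).
apply: exponential_of_laplace; first by rewrite divr_gt0// mulr_gt0.
  exact: (local_time_ge0 hB hW hs hL ha hab).
move=> lam lam0.
have := local_time_laplace hB hW hs hL ha hab (divr_gt0 lam0 eW).
rewrite (_ : (fun w => _) = (fun w =>
  expR (- (lam * L (fine (first_passage (brox W (B ^~ w)) b)) a w)))); last first.
  by apply/funext => w; rewrite mulrA divfK// gt_eqF.
congr (has_mean _ _ _).
field; rewrite !gt_eqF//=.
by rewrite addr_gt0// mulr_gt0// mulr_gt0.
Qed.
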